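(* Let $k\in\mathbb N$, $k\ge2$, and let $E$ be a symmetric space with the Fatou property. If $E^d$ is compactly fully $k$-rotund and strictly $K$-monotone, then $E$ is increasing uniformly $K$-monotone.
   Context: Let $I=[0,\alpha)$, $\alpha=1$ or $\alpha=\infty$, with Lebesgue measure $\mu$, and $L^0$ the set of (classes of) extended real valued measurable functions on $I$. A Banach function space $(E,\|\cdot\|_E)$ is a Banach lattice that is a sublattice of $L^0$ such that (1) if $x\in L^0$, $y\in E$, $|x|\le|y|$ a.e., then $x\in E$ and $\|x\|_E\le\|y\|_E$; (2) there is a strictly positive $x\in E$. $E^+=\{x\in E:x\ge0\}$; $S_E$ is the unit sphere. Fatou property: if $(x_n)\subset E^+$, $\sup_n\|x_n\|_E<\infty$ and $x_n\uparrow x\in L^0$, then $x\in E$ and $\|x_n\|_E\uparrow\|x\|_E$. For $x\in L^0$: $d_x(\lambda)=\mu\{s\in I:|x(s)|>\lambda\}$, $x^*(t)=\inf\{\lambda>0:d_x(\lambda)\le t\}$, $x^{**}(t)=\frac1t\int_0^t x^*(s)\,ds$. A symmetric space is a Banach function space $E$ such that $x\in L^0$, $y\in E$, $d_x=d_y$ imply $x\in E$ and $\|x\|_E=\|y\|_E$. $x\prec y$ means $x^{**}(t)\le y^{**}(t)$ for all $t>0$. $E^d=\{x^*:x\in E\}$ (the cone of nonnegative decreasing elements). A property holds on $E^d$ if its definition holds when only elements of $E^d$ are considered. $E^d$ is compactly fully $k$-rotund if every sequence $(x_n)\subset S_E\cap E^d$ such that $\|\sum_{i=1}^k x_{n,i}\|_E\to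 k$ as $n\to\infty$ for any $k$ subsequences $(x_{n,1})_n,\dots,(x_{n,k})_n$ of $(x_n)$ forms a relatively compact set. $E$ is strictly $K$-monotone if $x,y\in E$, $x\prec y$, $x^*\ne y^*$ imply $\|x\|_E<\|y\|_E$ (since this depends only on $x^*,y^*$, it is the same condition on $E^d$ as on $E$). $E$ is increasing uniformly $K$-monotone if for any $(x_n),(y_n)\subset E$ with $x_n\prec y_n\prec y_{n+1}$ for all $n\in\mathbb N$ and $\lim_n\|x_n\|_E=\lim_n\|y_n\|_E<\infty$ one has $\|x_n^*-y_n^*\|_E\to0$. *)

(* Defs.v *)
From HB Require Import structures.
From mathcomp Require Import all_boot all_order all_algebra.
From mathcomp Require Import all_classical all_reals all_analysis.
From mathcomp Require Import measurable_realfun.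

Set Implicit Arguments.
Unset Strict Implicit.
Unset Printing Implicit Defensive.
Import Order.TTheory GRing.Theory Num.Theory.
Import numFieldNormedType.Exports.
Local Open Scope classical_set_scope.
Local Open Scope ring_scope.

Section FunctionSpaces.
Variables (R : realType) (alpha : \bar R).
Implicit Types f g : R -> \bar R.

Local Notation mu := (@lebesgue_measure R).

Definition dom : set R := [set t : R | 0 <= t /\ (t%:E < alpha)%E].

(* Equality in L^0. Functions are defined on all of R, but only their values
   on dom matter; every class of Lebesgue measurable functions has a Borel
   representative, so Borel measurability loses nothing. *)
Definition eqL0 f g : Prop := ae_eq mu dom f g.

Definition distr f (l : R) : \bar R :=
  mu (dom `&` [set s | (l%:E < `|f s|)%E]).

(* Only meaningful for 0 <= t. The infimum is taken in \bar R, so it is +oo when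
   no l qualifies. *)
Definition rearr f (t : R) : \bar R :=
  ereal_inf [set l%:E | l in [set l : R | 0 < l /\ (distr f l <= t%:E)%E]].

Definition maxrearr f (t : R) : \bar R :=
  ((t^-1)%:E * \int[mu]_(s in `[0%R, t]) rearr f s)%E.

Definition submaj f g : Prop :=
  forall t : R, 0 < t -> (maxrearr f t <= maxrearr g t)%E.

(* A sublattice of L^0 that is a Banach lattice is represented by a Banach space
   E with a map ev choosing a representative of each element of E; ev is
   injective and linear modulo a.e. equality. Linearity forces ev x to be finite
   a.e.: (x + - x) = 0, whereas +oo - oo = -oo in \bar R. *)
Record banach_function_space (E : completeNormedModType R)
    (ev : E -> R -> \bar R) : Prop := BanachFunctionSpace {
  bfs_measurable : forall x : E, measurable_fun dom (ev x) ;
  bfs_inj : forall x y : E, eqL0 (ev x) (ev y) -> x = y ;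
  bfs_add : forall x y : E,
    eqL0 (ev (x + y)) (fun t => ev x t + ev y t)%E ;
  bfs_scale : forall (a : R) (x : E),
    eqL0 (ev (a *: x)) (fun t => a%:E * ev x t)%E ;
  bfs_max : forall x y : E,
    exists z : E, eqL0 (ev z) (fun t => maxe (ev x t) (ev y t)) ;
  bfs_min : forall x y : E,
    exists z : E, eqL0 (ev z) (fun t => mine (ev x t) (ev y t)) ;
  bfs_ideal : forall f (y : E), measurable_fun dom f ->
    {ae mu, forall t, dom t -> (`|f t| <= `|ev y t|)%E} ->
    exists2 x : E, eqL0 (ev x) f & `|x| <= `|y| ;
  bfs_weak_unit :
    exists x : E, {ae mu, forall t, dom t -> (0 < ev x t)%E} }.

Record symmetric_space (E : completeNormedModType R)
    (ev : E -> R -> \bar R) : Prop := SymmetricSpace {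
  sym_bfs : banach_function_space ev ;
  sym_equimeasurable : forall f (y : E), measurable_fun dom f ->
    distr f = distr (ev y) ->
    exists2 x : E, eqL0 (ev x) f & `|x| = `|y| }.

Definition fatou_property (E : completeNormedModType R)
    (ev : E -> R -> \bar R) : Prop :=
  forall (x : nat -> E) f, measurable_fun dom f ->
    (forall n, {ae mu, forall t, dom t -> (0 <= ev (x n) t)%E}) ->
    (exists M : R, forall n, `|x n| <= M) ->
    {ae mu, forall t, dom t -> nondecreasing_seq (fun n => ev (x n) t) /\
                               ev (x n) t @[n --> \oo] --> f t} ->
    exists z : E, [/\ eqL0 (ev z) f,
                      nondecreasing_seq (fun n => `|x n|) &
                      `|x n| @[n --> \oo] --> `|z|].

(* E^d *)
Definition decr_cone (E : completeNormedModType R)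
    (ev : E -> R -> \bar R) : set E :=
  [set z : E | exists x : E, eqL0 (ev z) (rearr (ev x))].

Definition compactly_fully_rotund_on (E : completeNormedModType R) (k : nat)
    (A : set E) : Prop :=
  forall x : nat -> E,
    (forall n, A (x n) /\ `|x n| = 1) ->
    (forall phi : 'I_k -> nat -> nat,
       (forall i m n, (m < n)%N -> (phi i m < phi i n)%N) ->
       `|\sum_(i < k) x (phi i n)| @[n --> \oo] --> (k%:R : R)) ->
    precompact (range x).

Definition strictly_K_monotone_on (E : completeNormedModType R)
    (ev : E -> R -> \bar R) (A : set E) : Prop :=
  forall x y : E, A x -> A y -> submaj (ev x) (ev y) ->
    ~ eqL0 (rearr (ev x)) (rearr (ev y)) -> `|x| < `|y|.

(* xs n and ys n are the elements of E represented by the rearrangements of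
   x n and y n; they are unique since ev is injective. *)
Definition increasing_uniformly_K_monotone (E : completeNormedModType R)
    (ev : E -> R -> \bar R) : Prop :=
  forall (x y : nat -> E) (l : R),
    (forall n, submaj (ev (x n)) (ev (y n)) /\
               submaj (ev (y n)) (ev (y n.+1))) ->
    `|x n| @[n --> \oo] --> l -> `|y n| @[n --> \oo] --> l ->
    exists xs ys : nat -> E,
      [/\ forall n, eqL0 (ev (xs n)) (rearr (ev (x n))),
          forall n, eqL0 (ev (ys n)) (rearr (ev (y n))) &
          `|xs n - ys n| @[n --> \oo] --> (0 : R)].

End FunctionSpaces.

(* Main.v *)
(* Replacing functions by their rearrangements, take all of them in E^d and write
   X(t) for the integral of x over [0, t]; strict K-monotonicity gives |x| <= |y|
   whenever X <= Y. As y_n increases for submajorization, any sum of k terms of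
   index >= n submajorizes k y_n, so compact full rotundity makes (y_n) relatively
   compact; since Y_n increases and x |-> X(t) is norm continuous on E^d, there
   is only one cluster point y. Now X_n <= Y and |x_n| --> |y|. If 0 < nu < y(t)
   and x_n(t) < nu, then X_n(s) <= min(Y(s), Y(t) + nu (s - t)); the right-hand
   side is the primitive of some z <> y submajorized by y, whence
   |x_n| <= |z| < |y|. Therefore liminf x_n >= y, and by the Fatou property the
   norms of inf_(m >= n) x_m tend to |y|. This makes compact full rotundity
   applicable to (x_n) too, and a cluster point w satisfies W <= Y and |w| = |y|,
   so w = y by strict K-monotonicity. *)
Require Import Defs.
From HB Require Import structures.
From mathcomp Require Import all_boot all_order all_algebra.
From mathcomp Require Import all_classical all_reals all_analysis.
From mathcomp Require Import measurable_realfun.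
From mathcomp Require Import ring lra.

Set Implicit Arguments.
Unset Strict Implicit.
Unset Printing Implicit Defensive.
Import Order.TTheory GRing.Theory Num.Theory.
Import numFieldNormedType.Exports.
Local Open Scope classical_set_scope.
Local Open Scope ring_scope.

(** Norm continuity of X(t) comes from comparing x with multiples of the indicator of [0, 1/2), an
    interval inside the domain for both values of alpha; the same comparison shows that X(t) is
    finite at all. Primitives are only subadditive in general, so sums and differences are taken
    inside E^d, where an element is its own rearrangement; this in turn requires that E^d contain
    the cluster points of its sequences. The minimum of Y and the line has a decreasing derivative
    because Y, having left the line upwards at t, can only come back to it with a slope of at most
    nu. The point b of return is taken finite, which for infinite alpha uses that y falls below
    every positive level at infinity; that too is extracted from rotundity. Rotundity speaks of unit
    vectors, so a limit norm equal to 0 is set apart. *)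

Section SymmetricSpaces.
Variables (R : realType) (alpha : \bar R).
Hypothesis halpha : alpha = 1%:E \/ alpha = +oo%E.
Implicit Types (f g : R -> \bar R) (l t : R).
Local Notation mu := (@lebesgue_measure R).
Local Notation dom := (dom alpha).
Local Notation distr := (distr alpha).
Local Notation rearr := (rearr alpha).

(** * The domain and level sets *)

#[local] Instance ae_mu_filter : Filter (nbhs (almost_everywhere mu)).
Proof. exact: (ae_filter_ringOfSetsType mu). Qed.

Lemma mu_le (A B : set R) : measurable A -> measurable B -> A `<=` B ->
  (mu A <= mu B)%E.
Proof. by move=> mA mB AB; apply: le_measure => //; exact: mem_set. Qed.

Lemma alpha_gt0 : (0 < alpha)%E.
Proof. by case: halpha => -> //; rewrite lte_fin. Qed.

Lemma dom_itv : dom = [set` Interval (BLeft 0) (if alpha is a%:E then BLeft a else +oo%O)].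
Proof.
apply/seteqP; case: halpha => ->; split => t; rewrite /Defs.dom /= in_itv/= ?lte_fin ?ltry ?andbT.
- by case=> -> ->.
- by move/andP.
- by case.
- by [].
Qed.

Lemma measurable_dom : measurable dom.
Proof. by rewrite dom_itv; exact: measurable_itv. Qed.
Hint Resolve measurable_dom : core.

Lemma mu_dom : mu dom = alpha.
Proof.
rewrite dom_itv lebesgue_measure_itv/=; case: halpha => -> /=.
- by rewrite lte_fin ltr01 sube0.
- by rewrite ltry addye.
Qed.

Lemma measurable_level f l : measurable_fun dom f ->
  measurable (dom `&` [set s | (l%:E < `|f s|)%E]).
Proof.
move=> mf; apply: emeasurable_fun_o_infty measurable_dom _ _.
by apply: measurableT_comp mf; exact: abse_measurable.
Qed.

(** * Decreasing rearrangements *)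

Lemma distr_ge0 f l : (0 <= distr f l)%E.
Proof. exact: measure_ge0. Qed.

Lemma distr_le_alpha f l : measurable_fun dom f -> (distr f l <= alpha)%E.
Proof.
move=> mf; rewrite -[leRHS]mu_dom; apply: mu_le => //.
exact: measurable_level.
Qed.

Lemma distr_le_ae f g l : measurable_fun dom f -> measurable_fun dom g ->
  {ae mu, forall t, dom t -> (`|f t| <= `|g t|)%E} ->
  (distr f l <= distr g l)%E.
Proof.
move=> mf mg [N [mN N0 subN]].
have mlg := measurable_level l mg.
have -> : distr g l = mu ((dom `&` [set s | (l%:E < `|g s|)%E]) `|` N).
  by rewrite measureU0.
apply: mu_le; [exact: (measurable_level _ mf)|exact: measurableU|].
move=> s [ds lf]; have [Ns|nNs] := pselect (N s); first by right.
left; split => //=; apply: (lt_le_trans lf).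
by apply: contrapT => h; apply: nNs; apply: subN => /= /(_ ds).
Qed.

Lemma distr_noninc f l1 l2 : measurable_fun dom f ->
  l1 <= l2 -> (distr f l2 <= distr f l1)%E.
Proof.
move=> mf l12; apply: mu_le; [exact: (measurable_level _ mf)|exact: (measurable_level _ mf)|].
by move=> s [ds /=] h; split => //=; apply: le_lt_trans h; rewrite lee_fin.
Qed.

Lemma rearr_ge0 f t : (0 <= rearr f t)%E.
Proof. by apply: le_ereal_inf_tmp => _ [l [l0 _] <-]; rewrite lee_fin ltW. Qed.

Lemma rearr_noninc f s t : s <= t -> (rearr f t <= rearr f s)%E.
Proof.
move=> st; apply: ereal_inf_le_tmp => _ [l [l0 h] <-]; exists l => //; split => //.
by apply: (le_trans h); rewrite lee_fin.
Qed.

(** [distr f] is right continuous: the level sets at [l + 1/(n+1)] increase to the one at [l], so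
    [t < distr f l] persists at some higher level, which then bounds the infimum from below. Through
    this equivalence [rearr f] acts as a generalized inverse of [distr f]. *)
Lemma rearr_gt f l t : measurable_fun dom f -> 0 <= l ->
  (l%:E < rearr f t)%E = (t%:E < distr f l)%E.
Proof.
move=> mf l0; apply/idP/idP; last first.
  move=> tl.
  pose F n := dom `&` [set s | ((l + n.+1%:R^-1)%:E < `|f s|)%E].
  have FE : dom `&` [set s | (l%:E < `|f s|)%E] = \bigcup_n F n.
    apply/seteqP; split => s /=.
      move=> [ds]; case fs : `|f s|%E => [r| |]// lr; last first.
        by exists 0%N => //; split => //=; rewrite fs ltry.
      have rl : 0 < r - l by rewrite subr_gt0 -lte_fin.
      have [n hn] := ltr_add_invr rl.
      exists n => //; split => //=; rewrite fs lte_fin.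
      by rewrite add0r in hn; rewrite -ltrBrDl.
    by move=> [n _ [ds /= h]]; split => //; apply: le_lt_trans h; rewrite lee_fin lerDl.
  have ndF : nondecreasing_seq F.
    move=> m n mn; apply/subsetPset => s [ds /= h]; split => //=.
    by apply: le_lt_trans h; rewrite lee_fin lerD2l lef_pV2 ?posrE// ler_nat.
  have mF n : measurable (F n) by exact: (measurable_level _ mf).
  have cF : mu (F n) @[n --> \oo] --> distr f l.
    rewrite /Defs.distr FE; apply: nondecreasing_cvg_mu => //.
    exact: bigcupT_measurable.
  have [n tn] : exists n, (t%:E < mu (F n))%E.
    apply: contrapT => /forallNP h; move: tl; apply/negP; rewrite -leNgt.
    rewrite -(cvg_lim _ cF)//; apply: lime_le.
      by apply/cvg_ex; eexists; exact: cF.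
    by near=> n; rewrite leNgt; apply/negP.
  apply: (@lt_le_trans _ _ (l + n.+1%:R^-1)%:E); first by rewrite lte_fin ltrDl.
  apply: le_ereal_inf_tmp => _ [r [r0 hr] <-]; rewrite lee_fin leNgt; apply/negP => rl.
  have := le_trans (distr_noninc mf (ltW rl)) hr; apply/negP.
  by rewrite -ltNge.
apply: contraTT; rewrite -!leNgt => dl; apply/lee_addgt0Pr => e e0.
(* [l] may be 0, whereas the infimum only admits positive levels. *)
apply: ereal_inf_lbound; exists (l + e); rewrite ?EFinD//; split.
  by rewrite ltr_wpDl.
by apply: le_trans dl; apply: distr_noninc => //; rewrite lerDl ltW.
Unshelve. all: by end_near. Qed.

Lemma rearr_off f t : measurable_fun dom f -> 0 <= t -> ~ dom t -> rearr f t = 0%E.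
Proof.
move=> mf t0 ndt; apply/eqP; rewrite eq_le rearr_ge0 andbT leNgt; apply/negP.
rewrite rearr_gt//; apply/negP; rewrite -leNgt.
apply: (le_trans (distr_le_alpha _ _)) => //.
by rewrite leNgt; apply/negP => h; apply: ndt.
Qed.

(** Superlevel sets of a decreasing function on an interval are intervals. *)
Lemma measurable_noninc (D : set R) f : measurable D ->
  {in D &, forall s t, s <= t -> (f t <= f s)%E} -> is_interval D -> measurable_fun D f.
Proof.
move=> mD nf iD.
apply: (measurability (@ErealGenOInfty.G R)).
  exact: ErealGenOInfty.measurableE.
move=> _ [_ [r ->] <-]; apply: is_interval_measurable => s t /=.
rewrite !in_itv/= !andbT => -[Ds fs] [Dt ft] u /andP[su ut].
have Du : D u by apply: (iD s t) => //; rewrite su ut.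
by split => //=; rewrite in_itv/= andbT; apply: (lt_le_trans ft); apply: nf; rewrite ?inE.
Qed.

Lemma measurable_rearr f (D : set R) : measurable D -> measurable_fun D (rearr f).
Proof.
move=> mD; apply: (@measurable_funS _ _ _ _ setT) => //.
by apply: measurable_noninc => // s t _ _; exact: rearr_noninc.
Qed.

Lemma mu_dom_lt (x : \bar R) : (0 <= x)%E -> (x <= alpha)%E ->
  mu (dom `&` [set s | (s%:E < x)%E]) = x.
Proof.
move=> x0 xa.
have -> : dom `&` [set s | (s%:E < x)%E] = [set s | 0 <= s /\ (s%:E < x)%E].
  apply/seteqP; split => s /=; first by case=> [[]].
  by move=> [s0 sx]; split => //; split => //; exact: lt_le_trans xa.
case: x x0 {xa} => [r|_|//]; last first.
  rewrite [X in mu X](_ : _ = `[0, +oo[%classic).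
    by rewrite lebesgue_measure_itv/= ltry addye.
  by apply/seteqP; split => s /=; rewrite in_itv/= andbT ?ltry//; case.
rewrite lee_fin => r0; rewrite [X in mu X](_ : _ = `[0, r[%classic).
  rewrite lebesgue_measure_itv/= lte_fin; case: ltP => h; first by rewrite sube0.
  by congr (_%:E); apply/eqP; rewrite eq_le r0 h.
by apply/seteqP; split => s /=; rewrite in_itv/= lte_fin; [case=> -> ->|case/andP].
Qed.

(** By [rearr_gt] the level set of [rearr f] at [l >= 0] is the part of the domain to the left of
    [distr f l], whose measure is [distr f l]; for [l < 0] both level sets are the whole domain. *)
Lemma distr_rearr f : measurable_fun dom f -> distr (rearr f) = distr f.
Proof.
move=> mf; apply/funext => l; have [l0|l0] := ltP l 0.
  rewrite /Defs.distr; congr (mu _); apply/seteqP.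
  by split => s [ds _]; split => //=; rewrite (@lt_le_trans _ _ 0%E)// lte_fin.
rewrite /Defs.distr -[RHS](@mu_dom_lt (distr f l)) ?distr_ge0 ?distr_le_alpha//.
congr (mu (_ `&` _)); apply/seteqP; split => s /=;
  by rewrite gee0_abs ?rearr_ge0// rearr_gt.
Qed.

Lemma rearr_le_distr f g t : (forall l, 0 < l -> (distr f l <= distr g l)%E) ->
  (rearr f t <= rearr g t)%E.
Proof.
move=> fg; apply: ereal_inf_le_tmp => _ [l [l0 h] <-]; exists l => //; split => //.
exact: le_trans (fg l l0) h.
Qed.

Lemma rearr_le_ae f g t : measurable_fun dom f -> measurable_fun dom g ->
  {ae mu, forall t, dom t -> (`|f t| <= `|g t|)%E} ->
  (rearr f t <= rearr g t)%E.
Proof.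
by move=> mf mg fg; apply: rearr_le_distr => l _; exact: distr_le_ae.
Qed.

Lemma rearr_ae f g : measurable_fun dom f -> measurable_fun dom g ->
  eqL0 alpha f g -> rearr f = rearr g.
Proof.
move=> mf mg fg; apply/funext => t; apply/eqP; rewrite eq_le !rearr_le_ae//.
  by apply: filterS fg => s + ds => ->.
by apply: filterS fg => s + ds => ->.
Qed.

(** For [t < s] in the domain, [f s <= rearr f t <= f t], so the two functions differ only at jumps
    of [f]. Rationals chosen strictly inside these jumps are distinct, hence the exceptional set is
    countable. *)
Lemma rearr_decr f : (forall s, dom s -> (0 <= f s)%E) ->
  (forall s t, dom s -> dom t -> s <= t -> (f t <= f s)%E) ->
  eqL0 alpha (rearr f) f.
Proof.
move=> f0 df.
have mf : measurable_fun dom f.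
  apply: measurable_noninc => //; last by rewrite dom_itv; exact: interval_is_interval.
  by move=> s t; rewrite !inE; exact: df.
have le1 t : dom t -> (rearr f t <= f t)%E.
  move=> dt; case ft : (f t) (f0 t dt) => [r| |]//; rewrite ?leey// lee_fin => r0.
  rewrite leNgt rearr_gt// -leNgt.
  have t0 : 0 <= t by case: dt.
  rewrite (@le_trans _ _ (mu `[0, t]%classic))//; last first.
    by rewrite lebesgue_measure_itv/= lte_fin; case: ltP => h; rewrite ?sube0 ?lee_fin.
  apply: mu_le; [exact: (measurable_level _ mf)|exact: measurable_itv|].
  move=> s [ds /=]; rewrite gee0_abs ?f0// => rfs; rewrite in_itv/=.
  have -> /= : 0 <= s by case: ds.
  rewrite leNgt; apply/negP => ts; move: rfs; apply/negP; rewrite -leNgt -ft.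
  exact/df/ltW.
have le2 s t : dom s -> dom t -> t < s -> (f s <= rearr f t)%E.
  move=> ds dt ts; rewrite leNgt; apply/negP => h.
  have rt0 := rearr_ge0 f t.
  have : rearr f t \is a fin_num by rewrite ge0_fin_numE//; exact: lt_le_trans h (leey _).
  move=> /fineK rt; rewrite -rt in h.
  have r0 : 0 <= fine (rearr f t) by rewrite fine_ge0.
  have : ~~ ((fine (rearr f t))%:E < rearr f t)%E by rewrite rt ltxx.
  rewrite rearr_gt// -leNgt; apply/negP; rewrite -ltNge.
  apply: (@lt_le_trans _ _ s%:E); first by rewrite lte_fin.
  have s0 : 0 <= s by case: ds.
  rewrite (@le_trans _ _ (mu `[0, s]%classic))//.
    rewrite lebesgue_measure_itv/= lte_fin sube0; case: ltP => //.
  apply: mu_le; [exact: measurable_itv|exact: (measurable_level _ mf)|].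
  move=> u /=; rewrite in_itv/= => /andP[u0 us].
  have du : dom u by split => //; apply: le_lt_trans ds.2; rewrite lee_fin.
  split => //=; rewrite gee0_abs ?f0//; apply: (lt_le_trans h).
  exact: df.
pose A := [set t | dom t /\ (rearr f t < f t)%E].
have /choice[q hq] : forall t, exists q : rat, A t ->
    (rearr f t < (ratr q)%:E)%E /\ ((ratr q)%:E < f t)%E.
  move=> t; have [[dt h]|?] := pselect (A t); last by exists 0.
  have : rearr f t \is a fin_num.
    by rewrite ge0_fin_numE ?rearr_ge0//; exact: lt_le_trans h (leey _).
  move=> /fineK rt; rewrite -rt in h *.
  case ft : (f t) h => [r| |]// h.
    rewrite lte_fin in h; have [p] := rat_in_itvoo h.
    by rewrite in_itv/= => /andP[p1 p2]; exists p; rewrite !lte_fin.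
  have : fine (rearr f t) < fine (rearr f t) + 1 by rewrite ltrDl.
  move=> /rat_in_itvoo[p]; rewrite in_itv/= => /andP[p1 p2]; exists p.
  by rewrite !lte_fin ltry.
have cA : countable A.
  apply/countable_injP; exists (pickle \o q) => t s; rewrite !inE => At As /(pcan_inj pickleK) qts.
  have [t1 t2] := hq _ At; have [s1 s2] := hq _ As; apply/eqP.
  have aux x y : A x -> A y -> q x = q y -> ~ (x < y).
    move=> Ax Ay qxy xy; have [x1 _] := hq _ Ax; have [_ y2] := hq _ Ay.
    rewrite -qxy in y2; have := lt_trans x1 (lt_le_trans y2 (le2 _ _ Ay.1 Ax.1 xy)).
    by rewrite ltxx.
  by case: (ltgtP t s) => [ts|st|//]; [case: (aux t s)|case: (aux s t)].
exists A; split; [|exact: countable_lebesgue_measure0|].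
  exact: countable_measurable.
move=> t /= /not_implyP[dt nt]; split => //.
by rewrite lt_neqAle le1// andbT; apply/eqP.
Qed.


(** * The layer cake formula and a Hardy-Littlewood inequality *)

Lemma measurable_level_measure (D : set R) (g : R -> \bar R) :
  measurable D -> measurable_fun D g ->
  measurable_fun setT (fun l => mu (D `&` [set s | (l%:E < g s)%E])).
Proof.
move=> mD mg; apply: measurable_noninc => // l1 l2 _ _ l12.
apply: mu_le; [exact: emeasurable_fun_o_infty|exact: emeasurable_fun_o_infty|].
by move=> s [Ds /= h]; split => //=; apply: le_lt_trans h; rewrite lee_fin.
Qed.

(** Tonelli's theorem for the region under the graph of [g], extended by 0 outside [D]. *)
Lemma layer_cake (D : set R) (g : R -> \bar R) : measurable D ->
  measurable_fun D g -> (forall s, (0 <= g s)%E) ->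
  (\int[mu]_(s in D) g s =
   \int[mu]_(l in `[0%R, +oo[) mu (D `&` [set s | (l%:E < g s)%E]))%E.
Proof.
move=> mD mg g0; pose G := g \_ D.
have mG : measurable_fun setT G by exact: (measurable_restrictT g mD).1 mg.
have G0 s : (0 <= G s)%E by rewrite /G patchE; case: ifP.
pose A := [set p : R * R | (0 <= p.2) /\ (p.2%:E < G p.1)%E].
pose F (p : R * R) := ((\1_A p : R)%:E)%E.
have mA : measurable A.
  rewrite (_ : A = (setT `&` [set p | (cst 0 p <= p.2%:E)%E]) `&`
    (setT `&` [set p | (p.2%:E < G p.1)%E])); last first.
    by apply/seteqP; split => p /=; rewrite lee_fin; [case|case=> [[_ +] [_]]].
  have m2 : measurable_fun setT (fun p : R * R => p.2%:E).
    by apply/measurable_EFinP; exact: measurable_snd.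
  apply: measurableI; first exact: measurable_lee.
  apply: measurable_lte => //.
  by apply: (@measurableT_comp _ _ _ _ _ _ G) => //; exact: measurable_fst.
have mF : measurable_fun setT F.
  by apply/measurable_EFinP; exact: measurable_indic.
have F0 p : (0 <= F p)%E by rewrite lee_fin.
have := @fubini_tonelli _ _ _ _ R mu mu F mF F0.
rewrite (_ : \int[mu]_s _ = \int[mu]_(s in D) g s)%E; last first.
  rewrite [RHS]integral_mkcond; apply: eq_integral => s _.
  have -> : (fun y => F (s, y)) = fun y => (\1_([set l | 0 <= l /\ (l%:E < G s)%E]) y : R)%:E.
    by [].
  have -> : [set l | 0 <= l /\ (l%:E < G s)%E] =
      [set` Interval (BLeft 0) (if G s is r%:E then BLeft r else +oo%O)].
    apply/seteqP; split => l /=; rewrite in_itv/=; move: (G0 s); case: (G s) => [r| |]//= _.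
    + by case=> -> ; rewrite lte_fin => ->.
    + by case=> ->.
    + by case/andP => ->; rewrite lte_fin.
    + by rewrite ltry andbT.
  rewrite integral_indic//= setIT lebesgue_measure_itv/=.
  rewrite -/(G s); move: (G0 s); case: (G s) => [r| |]//=; last by rewrite ltry addye.
  rewrite lee_fin lte_fin => r0; case: ltP => h; first by rewrite sube0.
  by congr _%:E; apply/eqP; rewrite eq_le r0 h.
move=> ->; rewrite [RHS]integral_mkcond; apply: eq_integral => l _.
rewrite patchE; case: ifPn => [|/negP nl].
  rewrite inE/= in_itv/= andbT => l0.
  have -> : (fun x => F (x, l)) = fun x => (\1_(D `&` [set s | (l%:E < g s)%E]) x : R)%:E.
    apply/funext => x; congr (_%:E); rewrite !indicE; congr (_%:R).
    congr (nat_of_bool _); apply/idP/idP; rewrite !inE /A /G /= patchE.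
      by case: ifPn => [/set_mem Dx []|_ [_]] //; rewrite lte_fin ltNge l0.
    by case=> Dx h; rewrite mem_set.
  by rewrite integral_indic ?setIT//; exact: emeasurable_fun_o_infty.
rewrite (_ : (fun x => F (x, l)) = cst 0%E) ?integral0//.
apply/funext => x; rewrite /F indicE memNset// => -[/= l0 _]; apply: nl.
by rewrite inE/= in_itv/= l0.
Qed.

(** The inequality holds level by level in the layer cake: at level [l] the set on the left has
    measure at most both [t] and [distr f l], and the one on the right has measure equal to the
    smaller of these. *)
Lemma integral_abs_le_rearr f t : measurable_fun dom f -> 0 <= t ->
  (\int[mu]_(s in dom `&` `[0%R, t]) `|f s| <= \int[mu]_(s in `[0%R, t]) rearr f s)%E.
Proof.
move=> mf t0.
have mt : measurable (`[0%R, t]%classic : set R) by exact: measurable_itv.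
have mdt : measurable (dom `&` `[0%R, t]%classic) by exact: measurableI.
have maf : measurable_fun dom (fun s => `|f s|%E).
  by apply: measurableT_comp mf; exact: abse_measurable.
have madt : measurable_fun (dom `&` `[0%R, t]%classic) (fun s => `|f s|%E).
  by apply: measurable_funS maf => //; move=> s [].
have mrt : measurable_fun `[0%R, t]%classic (rearr f) by exact: measurable_rearr.
rewrite layer_cake// (@layer_cake _ (rearr f))//; last by move=> s; exact: rearr_ge0.
apply: ge0_le_integral => //.
- by apply: measurable_funS (measurable_level_measure mdt madt).
- by apply: measurable_funS (measurable_level_measure mt mrt).
move=> l /=; rewrite in_itv/= andbT => l0.
have ml := measurable_level l mf.
have mr : measurable (`[0%R, t] `&` [set s | (l%:E < rearr f s)%E]).
  exact: emeasurable_fun_o_infty.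
have ma : measurable (dom `&` `[0%R, t] `&` [set s | (l%:E < `|f s|)%E]).
  exact: emeasurable_fun_o_infty.
have [dt|td] := leP (distr f l) t%:E.
  apply: (@le_trans _ _ (distr f l)).
    by apply: mu_le => // s [[ds _] h]; split.
  rewrite -{1}(mu_dom_lt (distr_ge0 f l) (distr_le_alpha l mf)); apply: mu_le => //.
    rewrite (_ : [set s | _] = [set s | (l%:E < rearr f s)%E]).
      by apply: emeasurable_fun_o_infty => //; exact: measurable_rearr.
    by apply/funext => s /=; rewrite rearr_gt.
  move=> s [ds /= sd]; split => /=.
    rewrite in_itv/=; case: ds => -> /= _.
    by rewrite -lee_fin (le_trans (ltW sd)).
  by rewrite rearr_gt.
rewrite (_ : `[0%R, t] `&` [set s | (l%:E < rearr f s)%E] = `[0%R, t]%classic).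
  by apply: mu_le => // s [[]].
apply/seteqP; split => s; first by case.
move=> st; split => //=; rewrite rearr_gt//; apply: le_lt_trans td.
by move: st => /=; rewrite in_itv/= lee_fin => /andP[].
Qed.

(** * Primitives of rearrangements *)

(** For [t > 0] this is [t] times [maxrearr]; as the primitive of a decreasing function it is
    concave wherever it is finite. *)
Definition prim f t : \bar R := (\int[mu]_(s in `[0%R, t]) rearr f s)%E.

Lemma submajP f g : submaj alpha f g <-> forall t, 0 < t -> (prim f t <= prim g t)%E.
Proof.
split => h t t0; have := h t t0; rewrite /maxrearr -/(prim f t) -/(prim g t).
  by rewrite lee_pmul2l// lte_fin invr_gt0.
by move=> ?; rewrite lee_pmul2l// lte_fin invr_gt0.
Qed.

Lemma prim_ge0 f t : (0 <= prim f t)%E.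
Proof. by apply: integral_ge0 => s _; exact: rearr_ge0. Qed.

Lemma prim0 f : prim f 0 = 0%E.
Proof.
by rewrite /prim set_itv1 integral_set1.
Qed.

Lemma prim_split f s t : 0 <= s -> s <= t ->
  prim f t = (prim f s + \int[mu]_(u in `]s, t]) rearr f u)%E.
Proof.
move=> s0 st; rewrite /prim -ge0_integral_setU//.
- by rewrite -itv_bndbnd_setU// !bnd_simp.
- by apply: measurable_rearr; exact: measurableU.
- by move=> *; exact: rearr_ge0.
- apply/disj_setPS => u [/=]; rewrite !in_itv/= => /andP[_ us] /andP[su _].
  by move: (le_lt_trans us su); rewrite ltxx.
Qed.

Lemma integral_cst_itv s t (c : \bar R) : s <= t ->
  (\int[mu]_(u in `]s, t]) cst c u = (t - s)%:E * c)%E.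
Proof.
move=> st; transitivity (c * mu `]s, t]%classic)%E; first exact: integral_cst.
rewrite muleC lebesgue_measure_itv/= lte_fin.
case: ltP => // ts; congr (_%:E * _)%E; apply/esym/eqP.
by rewrite subr_eq0 eq_le ts st.
Qed.

Lemma prim_lower f s t : 0 <= s -> s <= t ->
  (prim f s + (t - s)%:E * rearr f t <= prim f t)%E.
Proof.
move=> s0 st; rewrite (prim_split f s0 st) leeD2l//.
rewrite -(integral_cst_itv (rearr f t) st); apply: ge0_le_integral; first exact: measurable_itv.
- by move=> *; exact: rearr_ge0.
- exact: measurable_cst.
- exact: measurable_rearr.
- by move=> u /=; rewrite in_itv/= => /andP[_ ut]; exact: rearr_noninc.
Qed.

Lemma prim_upper f s t : 0 <= s -> s <= t ->
  (prim f t <= prim f s + (t - s)%:E * rearr f s)%E.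
Proof.
move=> s0 st; rewrite (prim_split f s0 st) leeD2l//.
rewrite -(integral_cst_itv (rearr f s) st); apply: ge0_le_integral; first exact: measurable_itv.
- by move=> *; exact: rearr_ge0.
- exact: measurable_rearr.
- exact: measurable_cst.
- by move=> u /=; rewrite in_itv/= => /andP[su _]; exact/rearr_noninc/ltW.
Qed.

Lemma prim_le f s t : 0 <= s -> s <= t -> (prim f s <= prim f t)%E.
Proof.
move=> s0 st; rewrite (prim_split f s0 st) leeDl//.
by apply: integral_ge0 => u _; exact: rearr_ge0.
Qed.

Lemma prim_le_rearr f g t : (forall s, (rearr f s <= rearr g s)%E) ->
  (prim f t <= prim g t)%E.
Proof.
move=> fg; apply: ge0_le_integral; first exact: measurable_itv.
- by move=> *; exact: rearr_ge0.
- by apply: measurable_rearr; exact: measurable_itv.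
- by apply: measurable_rearr; exact: measurable_itv.
- by move=> s _; exact: fg.
Qed.

(** Concavity together with [prim f 0 = 0] makes [prim f t / t] decreasing. *)
Lemma prim_ratio f s t : 0 < s -> s <= t ->
  (prim f t <= (t / s)%:E * prim f s)%E.
Proof.
move=> s0 st; apply: (le_trans (prim_upper f (ltW s0) st)).
have -> : (t / s)%:E = (1 + ((t - s) / s)%:E)%E.
  by rewrite -EFinD; congr (_%:E); rewrite mulrBl divff ?gt_eqF// addrC subrK.
have h0 : 0 <= (t - s) / s by rewrite divr_ge0 ?subr_ge0// ltW.
rewrite ge0_muleDl ?lee_fin// mul1e.
rewrite leeD2l// EFinM -muleA; apply: lee_wpmul2l; rewrite ?lee_fin ?subr_ge0//.
have := prim_lower f (lexx 0) (ltW s0); rewrite prim0 add0e subr0 => h.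
by rewrite lee_pdivlMl.
Qed.

(** The part of [[0, t]] outside the domain contributes 0 by [rearr_off], so nothing is asked of [w]
    there. *)
Lemma prim_rep f w t : measurable_fun dom f -> measurable_fun dom w ->
  (forall s, dom s -> (0 <= w s)%E) -> eqL0 alpha (rearr f) w -> 0 <= t ->
  prim f t = (\int[mu]_(s in dom `&` `[0%R, t]) w s)%E.
Proof.
move=> mf mw w0 fw t0.
have mdt : measurable (dom `&` `[0%R, t]%classic).
  by apply: measurableI => //; exact: measurable_itv.
transitivity (\int[mu]_(s in dom `&` `[0%R, t]) rearr f s)%E.
  rewrite /prim integral_mkcond [RHS]integral_mkcond; apply: eq_integral => s _.
  rewrite !patchE; case: ifPn => [/set_mem st|nst].
    case: ifPn => // /negP nd; apply: rearr_off => //.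
      by move: st => /=; rewrite in_itv/= => /andP[].
    by move=> ds; apply: nd; apply/mem_set.
  case: ifPn => // /set_mem [_ h]; by move/negP: nst; rewrite mem_set.
apply: ge0_ae_eq_integral => //.
- exact: measurable_rearr.
- by apply: measurable_funS mw => //; move=> s [].
- by move=> *; exact: rearr_ge0.
- by move=> s [ds _]; exact: w0.
- by apply: filterS fw => s h [ds _]; exact: h.
Qed.

(** * Symmetric spaces and K-monotonicity *)

Variables (E : completeNormedModType R) (ev : E -> R -> \bar R).
Hypothesis hsym : symmetric_space alpha ev.
Local Notation cone := (decr_cone alpha ev).
Local Notation eqE := (eqL0 alpha).
Let hb := sym_bfs hsym.

Lemma ev_meas x : measurable_fun dom (ev x).
Proof. exact: (bfs_measurable hb). Qed.
Hint Resolve ev_meas : core.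

Lemma ev_inj x y : eqE (ev x) (ev y) -> x = y.
Proof. exact: (bfs_inj hb). Qed.

Lemma ev0 : eqE (ev 0) (cst 0%E).
Proof.
have := bfs_scale hb 0 0; rewrite scale0r => h.
by apply: filterS h => t h /h ->; rewrite mul0e.
Qed.

Lemma ev_opp x : eqE (ev (- x)) (fun t => - ev x t)%E.
Proof.
have := bfs_scale hb (-1) x; rewrite scaleN1r => h.
by apply: filterS h => t h /h ->; rewrite mulN1e.
Qed.

Lemma ev_fin x : {ae mu, forall t, dom t -> ev x t \is a fin_num}.
Proof.
have h1 := bfs_add hb x (- x); rewrite subrr in h1.
apply: filterS3 h1 (ev_opp x) ev0 => t h1 h2 h3 dt.
move: (h1 dt); rewrite h2// h3//=; by case: (ev x t).
Qed.

Lemma ev_sub x y : eqE (ev (x - y)) (fun t => ev x t - ev y t)%E.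
Proof.
by apply: filterS2 (bfs_add hb x (- y)) (ev_opp y) => t h1 h2 dt; rewrite h1// h2.
Qed.

Lemma ev_sum (I : Type) (r : seq I) (F : I -> E) :
  eqE (ev (\sum_(i <- r) F i)) (fun t => \sum_(i <- r) ev (F i) t)%E.
Proof.
elim: r => [|i r IH].
  by apply: filterS ev0 => t h /h; rewrite !big_nil.
have := bfs_add hb (F i) (\sum_(j <- r) F j).
rewrite big_cons => h; apply: filterS2 h IH => t h1 h2 dt.
by rewrite h1// h2// big_cons.
Qed.

Lemma norm_le x y : {ae mu, forall t, dom t -> (`|ev x t| <= `|ev y t|)%E} ->
  `|x| <= `|y|.
Proof. by move=> /(bfs_ideal hb (ev_meas x))[z /ev_inj ->]. Qed.

Lemma rearr_ev_eqE x f : measurable_fun dom f -> eqE (ev x) f ->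
  rearr (ev x) = rearr f.
Proof. by move=> mf; exact: rearr_ae. Qed.

Lemma rearr_rearr f : measurable_fun dom f -> rearr (rearr f) = rearr f.
Proof.
move=> mf; apply/funext => t; rewrite /Defs.rearr -/(rearr f).
by rewrite -/rearr distr_rearr.
Qed.

Lemma coneP x : cone x <-> eqE (ev x) (rearr (ev x)).
Proof.
split; last by exists x.
move=> [y xy]; rewrite (rearr_ev_eqE _ xy); last exact: measurable_rearr.
by rewrite rearr_rearr.
Qed.

Lemma measurable_decr (w : R -> \bar R) :
  (forall s t, dom s -> dom t -> s <= t -> (w t <= w s)%E) -> measurable_fun dom w.
Proof.
move=> dw; apply: measurable_noninc => //; last by rewrite dom_itv; exact: interval_is_interval.
by move=> s t; rewrite !inE; exact: dw.
Qed.

Lemma cone_rep x (w : R -> \bar R) : (forall s, dom s -> (0 <= w s)%E) ->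
  (forall s t, dom s -> dom t -> s <= t -> (w t <= w s)%E) ->
  eqE (ev x) w -> cone x /\ eqE (rearr (ev x)) w.
Proof.
move=> w0 dw xw; have h := rearr_decr w0 dw.
have e : rearr (ev x) = rearr w by apply: rearr_ev_eqE => //; exact: measurable_decr.
split; last by rewrite e.
by apply/coneP; rewrite e; apply: ae_eq_trans xw _; exact: ae_eq_sym.
Qed.

Lemma prim_cone x (w : R -> \bar R) t : (forall s, dom s -> (0 <= w s)%E) ->
  (forall s t, dom s -> dom t -> s <= t -> (w t <= w s)%E) ->
  eqE (ev x) w -> 0 <= t ->
  prim (ev x) t = (\int[mu]_(s in dom `&` `[0%R, t]) w s)%E.
Proof.
move=> w0 dw xw t0; apply: prim_rep => //; first exact: measurable_decr.
by have [] := cone_rep w0 dw xw.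
Qed.

Lemma rearr_elem x : exists xs, [/\ eqE (ev xs) (rearr (ev x)), `|xs| = `|x|,
  cone xs & rearr (ev xs) = rearr (ev x)].
Proof.
have [||xs h1 h2] := @sym_equimeasurable _ _ _ _ hsym (rearr (ev x)) x.
- exact: measurable_rearr.
- exact: distr_rearr.
exists xs; split => //; first by exists x.
by rewrite (rearr_ev_eqE _ h1) ?rearr_rearr//; exact: measurable_rearr.
Qed.

Hypothesis hskm : strictly_K_monotone_on alpha ev cone.

Lemma strict_mono x y : cone x -> cone y ->
  (forall t, 0 < t -> (prim (ev x) t <= prim (ev y) t)%E) -> `|y| <= `|x| -> x = y.
Proof.
move=> cx cy /submajP xy nyx; apply: contrapT => nxy.
have := hskm cx cy xy; rewrite ltNge nyx => h.
suff : false by []; apply: h => hxy; apply: nxy; apply: ev_inj.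
apply: ae_eq_trans (iffLR (coneP x) cx) _.
by apply: ae_eq_trans hxy _; apply: ae_eq_sym; exact/coneP.
Qed.

(** A counterexample, moved into the cone, would satisfy [|ys| < |xs|], and then the equality case
    [strict_mono] would force [xs = ys]. *)
Lemma kmono x y :
  (forall t, 0 < t -> (prim (ev x) t <= prim (ev y) t)%E) -> `|x| <= `|y|.
Proof.
move=> xy; have [xs [_ <- cxs ex]] := rearr_elem x; have [ys [_ <- cys ey]] := rearr_elem y.
rewrite leNgt; apply/negP => h; have := ltW h => /(strict_mono cxs cys).
by rewrite /prim ex ey => /(_ xy) e; move: h; rewrite e ltxx.
Qed.

(** * Indicators of initial intervals, and bounds on primitives by norms *)

Definition chi (b : R) : R -> \bar R := fun s => ((s < b)%R%:R : R)%:E.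

Lemma chi_ge0 (b s : R) : (0 <= chi b s)%E.
Proof. by rewrite lee_fin. Qed.

Lemma chi_decr (b s t : R) : s <= t -> (chi b t <= chi b s)%E.
Proof.
move=> st; rewrite lee_fin ler_nat; case: (ltP t b) => // tb.
by rewrite (le_lt_trans st).
Qed.

Lemma measurable_chi (b : R) : measurable_fun dom (chi b).
Proof. by apply: measurable_decr => s t _ _; exact: chi_decr. Qed.

Lemma ideal_mem f y : measurable_fun dom f ->
  {ae mu, forall t, dom t -> (`|f t| <= `|ev y t|)%E} ->
  exists x, eqE (ev x) f.
Proof. by move=> mf /(bfs_ideal hb mf)[x xf _]; exists x. Qed.

Lemma rearr_mem f y : measurable_fun dom f ->
  {ae mu, forall t, dom t -> (rearr f t <= `|ev y t|)%E} ->
  exists x, eqE (ev x) f.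
Proof.
move=> mf fy; have mr : measurable_fun dom (rearr f) by exact: measurable_rearr.
have [|x xf] := ideal_mem mr (y := y).
  by apply: filterS fy => t h /h ?; rewrite gee0_abs ?rearr_ge0.
have [|z zf _] := @sym_equimeasurable _ _ _ _ hsym f x mf; last by exists z.
rewrite -(distr_rearr mf); apply/funext => l; apply/eqP; rewrite eq_le.
by apply/andP; split; apply: distr_le_ae => //; apply: filterS xf => t h /h ->.
Qed.

(** A weak unit has full support, so its rearrangement is still positive at 1/2, an interior point
    of the domain for both values of [alpha], and dominates a multiple of the indicator. *)
Lemma chi_half : exists e, eqE (ev e) (chi 2^-1).
Proof.
have [w [N [mN N0 wN]]] := bfs_weak_unit hb.
have dw : distr (ev w) 0 = alpha.
  apply/eqP; rewrite eq_le distr_le_alpha//= -[leLHS]mu_dom.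
  have mlw := measurable_level 0 (ev_meas w).
  have -> : distr (ev w) 0 = mu ((dom `&` [set s | (0%:E < `|ev w s|)%E]) `|` N).
    by rewrite measureU0.
  apply: mu_le => //; first exact: measurableU.
  move=> s ds; have [Ns|nNs] := pselect (N s); first by right.
  left; split => //=; apply: contrapT => h; apply: nNs; apply: wN => /= /(_ ds) h0.
  by apply: h; rewrite gee0_abs// ltW.
have [ws [wsw _ _ _]] := rearr_elem w.
have r0 : (0 < rearr (ev w) 2^-1)%E.
  rewrite rearr_gt// dw; case: halpha => ->; rewrite ?ltry// lte_fin; lra.
have [l l0 lr] : exists2 l : R, 0 < l & (l%:E <= rearr (ev w) 2^-1)%E.
  move: r0; case: (rearr _ _) => [r| |]//; first by rewrite lte_fin => r0; exists r.
  by exists 1 => //; rewrite leey.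
have ml : measurable_fun dom (fun s => l%:E * chi 2^-1 s)%E.
  by apply: measurable_funeM; exact: measurable_chi.
have [|x xe] := ideal_mem ml (y := ws).
  apply: filterS wsw => t h /h ->.
  rewrite !gee0_abs ?rearr_ge0 ?mule_ge0 ?chi_ge0 ?lee_fin ?(ltW l0)//.
  rewrite /chi; case: ltP => t2; last by rewrite mule0 rearr_ge0.
  by rewrite mule1; apply: (le_trans lr); apply: rearr_noninc; exact: ltW.
exists (l^-1 *: x); apply: filterS2 xe (bfs_scale hb l^-1 x) => t h1 h2 dt.
by rewrite h2// h1// /chi -!EFinM mulKf ?gt_eqF.
Qed.

(** The indicator of [[b, b + b)] has a rearrangement below [chi b], so [rearr_mem] applies to it,
    and the two indicators add up to [chi (b + b)]. *)
Lemma chi_double (b : R) : 0 <= b -> (exists e, eqE (ev e) (chi b)) ->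
  exists e, eqE (ev e) (chi (b + b)).
Proof.
move=> b0 [e eb]; pose f (s : R) := ((b <= s < b + b)%R%:R : R)%:E.
have mf : measurable_fun dom f.
  apply: (@measurable_funS _ _ _ _ setT) => //; apply/measurable_EFinP.
  rewrite (_ : (fun s => _) = \1_(`[b, b + b[%classic : set R)); last first.
    by apply/funext => s; rewrite indicE mem_setE in_itv.
  by apply: measurable_indic; exact: measurable_itv.
have f0 s : (0 <= f s)%E by rewrite lee_fin.
have [|x xf] := rearr_mem mf (y := e).
  apply: filterS eb => t h dt; rewrite h// gee0_abs ?chi_ge0// /chi.
  have t0 : 0 <= t by case: dt.
  case: ltP => tb.
    rewrite leNgt rearr_gt// -leNgt [distr f 1](_ : _ = 0%E) ?lee_fin//.
    rewrite /Defs.distr [X in mu X](_ : _ = set0) ?measure0//.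
    apply/seteqP; split => // s [_ /=].
    by rewrite lte_fin; case: (_ && _); rewrite ?normr1 ?normr0 ?ltxx// ltr10.
  rewrite leNgt rearr_gt// -leNgt; apply: (@le_trans _ _ b%:E); rewrite ?lee_fin//.
  rewrite (@le_trans _ _ (mu `[b, b + b[%classic))//; last first.
    rewrite lebesgue_measure_itv/= lte_fin; case: ltP => ?; rewrite ?lee_fin//.
    by lra.
  apply: mu_le; [exact: measurable_level|exact: measurable_itv|move=> s [_ /=]].
  by rewrite lte_fin in_itv/=; case: (_ && _) => //; rewrite normr0 ltxx.
exists (e + x); apply: filterS3 eb xf (bfs_add hb e x) => t h1 h2 h3 dt.
rewrite h3// h1// h2// /chi /f -EFinD -natrD; congr (_%:R%:E).
by case: (ltP t b) => tb; case: (ltP t (b + b)) => tbb //=; exfalso; lra.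
Qed.

Lemma chi_mem (b : R) : exists e, eqE (ev e) (chi b).
Proof.
have h n : exists e, eqE (ev e) (chi (2^-1 * (2 ^ n)%:R)).
  elim: n => [|n IH]; first by rewrite mulr1; exact: chi_half.
  by rewrite expnS mul2n -addnn natrD mulrDr; apply: chi_double => //; rewrite mulr_ge0.
have [n bn] : exists n : nat, b <= 2^-1 * (2 ^ n)%:R.
  exists (Num.bound (2 * `|b|)).
  have := archi_boundP (mulr_ge0 (ler0n R 2) (normr_ge0 b)).
  set N := Num.bound _ => hN.
  have : N%:R <= (2 ^ N)%:R :> R by rewrite ler_nat ltnW// ltn_expl.
  by have := ler_norm b; lra.
have [e he] := h n; apply: (@ideal_mem _ e); first exact: measurable_chi.
apply: filterS he => t h1 /h1 ->; rewrite !gee0_abs ?chi_ge0// lee_fin ler_nat.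
by case: ltP => // tb; rewrite (lt_le_trans tb).
Qed.

Lemma integral_chi_le (a t c : R) : 0 <= t -> 0 <= a -> 0 <= c ->
  (\int[mu]_(s in dom `&` `[0%R, t]) (c%:E * chi a s) <= (c * Num.min t a)%:E)%E.
Proof.
move=> t0 a0 c0.
have mdt : measurable (dom `&` `[0%R, t]%classic).
  by apply: measurableI => //; exact: measurable_itv.
have ma : measurable (`[0%R, a[%classic : set R) by exact: measurable_itv.
rewrite ge0_integralZl_EFin//; last 2 first.
- by move=> s _; exact: chi_ge0.
- by apply: measurable_funS (measurable_chi a) => //; move=> s [].
rewrite EFinM; apply: lee_wpmul2l => //.
under eq_integral => s.
  rewrite inE => -[[s0 _] _].
  rewrite (_ : chi a s = (\1_(`[0%R, a[%classic : set R) s)%:E); last first.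
    by rewrite indicE mem_setE in_itv/= s0.
  over.
rewrite integral_indic//.
have mI : measurable (`[0%R, a[ `&` (dom `&` `[0%R, t])) by exact: measurableI.
rewrite /Num.min; case: ltP => ta.
  rewrite (@le_trans _ _ (mu `[0, t]%classic))//.
    by apply: mu_le => //= s [_ []].
  by rewrite lebesgue_measure_itv/= lte_fin sube0; case: ltP.
rewrite (@le_trans _ _ (mu `[0, a[%classic))//.
  by apply: mu_le => //= s [].
by rewrite lebesgue_measure_itv/= lte_fin sube0; case: ltP.
Qed.

Lemma chi_norm_gt0 (b : R) e : 0 < b -> eqE (ev e) (chi b) -> 0 < `|e|.
Proof.
move=> b0 ee; rewrite normr_gt0; apply/eqP => e0; rewrite e0 in ee.
pose a : R := Num.min b 2^-1.
have a0 : 0 < a by rewrite /a lt_min b0 invr_gt0 ltr0n.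
have mA : measurable (`[0%R, a[%classic : set R) by exact: measurable_itv.
have [M [mM M0 subM]] : {ae mu, forall t, dom t -> chi b t = 0%E}.
  by apply: filterS2 ee ev0 => t h1 h2 dt; rewrite -h1// h2.
suff : (mu `[0%R, a[%classic <= mu M)%E.
  by rewrite M0 lebesgue_measure_itv/= lte_fin a0 sube0 lee_fin leNgt a0.
apply: mu_le => // t /=; rewrite in_itv/= => /andP[t0]; rewrite lt_min => /andP[tb t2].
apply: subM => /=.
have dt : dom t by split => //; case: halpha => ->; rewrite ?ltry// lte_fin; lra.
by move=> /(_ dt); rewrite /chi tb => /eqP; rewrite eqe oner_eq0.
Qed.

(* If [c * a <= prim (ev x) a] then [c] times the indicator of [[0, a)] is
   submajorized by [x]; in particular all these integrals are finite. *)
Lemma prim_le_norm : exists K : R -> R, (forall t, 0 <= t -> 0 <= K t) /\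
  forall x t, 0 <= t -> (prim (ev x) t <= (K t * `|x|)%:E)%E.
Proof.
have [e ee] := chi_half; set a : R := 2^-1 in ee.
have a0 : 0 < a by rewrite /a; lra.
pose N := `|e|.
have N0 : 0 < N by exact: chi_norm_gt0 ee.
have key x c : 0 <= c -> ((c * a)%:E <= prim (ev x) a)%E -> c * N <= `|x|.
  move=> c0 cx; rewrite -{1}(ger0_norm c0) -normrZ; apply: kmono => t t0.
  rewrite (@prim_cone _ (fun s => c%:E * chi a s)%E); last 4 first.
  - by move=> s _; rewrite mule_ge0 ?chi_ge0.
  - by move=> u v _ _ uv; apply: lee_wpmul2l; [rewrite lee_fin|exact: chi_decr].
  - by apply: filterS2 ee (bfs_scale hb c e) => s h1 h2 ds; rewrite h2// h1.
  - exact: ltW.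
  apply: (le_trans (integral_chi_le (ltW t0) (ltW a0) c0)).
  have [ta|at_] := leP t a; last first.
    by apply: (le_trans cx); apply: prim_le (ltW at_); exact: ltW.
  have := prim_ratio (ev x) t0 ta; rewrite -lee_pdivrMl ?divr_gt0//; apply: le_trans.
  apply: (@le_trans _ _ (((a / t)^-1)%:E * (c * a)%:E)%E); last first.
    by apply: lee_wpmul2l => //; rewrite lee_fin invr_ge0 divr_ge0// ltW.
  by rewrite -EFinM lee_fin invf_div mulrCA divfK ?gt_eqF.
have a0' := ltW a0; have N0' := ltW N0.
(* For [t < a] the bound at [a] gives [a / N]; for [t >= a] it is multiplied by [t / a], which gives
   [t / N]. The sum covers both cases. *)
exists (fun t => (t + a) / N); split.
  by move=> t t0; rewrite divr_ge0 ?addr_ge0.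
have pa x : (prim (ev x) a <= (a * `|x| / N)%:E)%E.
  case px : (prim (ev x) a) (prim_ge0 (ev x) a) => [r| |]//.
    rewrite lee_fin => r0; have := @key x (r / a); rewrite divr_ge0// px lee_fin.
    rewrite divfK ?gt_eqF// => /(_ isT (lexx _)) h.
    rewrite lee_fin ler_pdivlMr// mulrC -ler_pdivrMl//; move: h.
    by rewrite [r / a]mulrC -mulrA [N * r]mulrC.
  (* If the primitive were infinite, every [c >= 0] would be admissible in [key]; this one yields
     [|x| + N <= |x|]. *)
  move=> _; have := @key x (`|x| / N + 1); rewrite addr_ge0 ?divr_ge0// px leey => /(_ isT isT).
  by rewrite mulrDl divfK ?gt_eqF// mul1r gerDl leNgt N0.
move=> x t t0; apply: (@le_trans _ _ ((t + a) * `|x| / N)%:E); last first.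
  by rewrite lee_fin mulrAC.
have [ta|at_] := ltP t a.
  apply: (le_trans (prim_le _ t0 (ltW ta))); apply: (le_trans (pa x)).
  by rewrite lee_fin -!mulrA ler_wpM2r ?mulr_ge0 ?invr_ge0// lerDr.
apply: (le_trans (prim_ratio _ a0 at_)).
apply: (@le_trans _ _ ((t / a)%:E * (a * `|x| / N)%:E)%E).
  by rewrite lee_wpmul2l ?lee_fin ?divr_ge0.
rewrite -EFinM lee_fin -!mulrA mulKf ?gt_eqF//.
by rewrite ler_wpM2r ?mulr_ge0 ?invr_ge0// lerDl.
Qed.

(* Both are sealed by Qed: otherwise a failed unification of [primR x t] with
   [primR y t] unfolds the integrals. *)
Lemma primR_sig : {primR : E -> R -> R | forall x t, primR x t = fine (prim (ev x) t)}.
Proof. by exists (fun x t => fine (prim (ev x) t)). Qed.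

Lemma rearrR_sig : {rearrR : E -> R -> R | forall x t, rearrR x t = fine (rearr (ev x) t)}.
Proof. by exists (fun x t => fine (rearr (ev x) t)). Qed.

Definition primR := sval primR_sig.
Definition rearrR := sval rearrR_sig.

Lemma primRE x t : primR x t = fine (prim (ev x) t).
Proof. exact: (svalP primR_sig). Qed.

Lemma rearrRE x t : rearrR x t = fine (rearr (ev x) t).
Proof. exact: (svalP rearrR_sig). Qed.

Lemma primE x t : 0 <= t -> prim (ev x) t = (primR x t)%:E.
Proof.
move=> t0; rewrite primRE fineK// ge0_fin_numE ?prim_ge0//.
by have [K [_ /(_ x t t0) h]] := prim_le_norm; exact: le_lt_trans h (ltry _).
Qed.

(** Here [t * rearr (ev x) t <= prim (ev x) t], which is finite. The point 0 is excluded because an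
    unbounded element has an infinite rearrangement there. *)
Lemma rearrE x t : 0 < t -> rearr (ev x) t = (rearrR x t)%:E.
Proof.
move=> t0; rewrite rearrRE fineK// ge0_fin_numE ?rearr_ge0//.
have := prim_lower (ev x) (lexx 0) (ltW t0).
rewrite prim0 add0e subr0 primE ?(ltW t0)// -lee_pdivlMl// => h.
by apply: le_lt_trans h _; rewrite -EFinM ltry.
Qed.

Lemma primR_ge0 x t : 0 <= primR x t.
Proof. by rewrite primRE fine_ge0// prim_ge0. Qed.

Lemma rearrR_ge0 x t : 0 <= rearrR x t.
Proof. by rewrite rearrRE fine_ge0// rearr_ge0. Qed.

Lemma primR_at0 x : primR x 0 = 0.
Proof. by rewrite primRE prim0. Qed.

Lemma primR_le x s t : 0 <= s -> s <= t -> primR x s <= primR x t.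
Proof.
by move=> s0 st; rewrite -lee_fin -!primE// ?prim_le//; exact: le_trans st.
Qed.

Lemma primR_lower x s t : 0 <= s -> s < t -> primR x s + (t - s) * rearrR x t <= primR x t.
Proof.
move=> s0 st; have t0 := le_lt_trans s0 st.
have := prim_lower (ev x) s0 (ltW st).
by rewrite !primE ?(ltW t0)// rearrE// -EFinM -EFinD lee_fin.
Qed.

Lemma primR_upper x s t : 0 < s -> s <= t -> primR x t <= primR x s + (t - s) * rearrR x s.
Proof.
move=> s0 st; have t0 := lt_le_trans s0 st.
have := prim_upper (ev x) (ltW s0) st.
by rewrite !primE ?(ltW t0) ?(ltW s0)// rearrE// -EFinM -EFinD lee_fin.
Qed.

Lemma kmono_primR x y : (forall t, 0 < t -> primR x t <= primR y t) -> `|x| <= `|y|.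
Proof.
move=> h; apply: kmono => t t0.
by rewrite (primE x (ltW t0)) (primE y (ltW t0)) lee_fin; exact: h.
Qed.

Lemma strict_mono_primR x y : cone x -> cone y ->
  (forall t, 0 < t -> primR x t <= primR y t) -> `|y| <= `|x| -> x = y.
Proof.
move=> cx cy h; apply: (strict_mono cx cy) => t t0.
by rewrite (primE x (ltW t0)) (primE y (ltW t0)) lee_fin; exact: h.
Qed.

(** * Primitives on the cone E^d, and limits of its elements *)

Lemma prim_dom x t : 0 <= t ->
  prim (ev x) t = (\int[mu]_(s in dom `&` `[0%R, t]) rearr (ev x) s)%E.
Proof.
move=> t0; apply: prim_rep => //; first exact: measurable_rearr.
  by move=> *; exact: rearr_ge0.
exact: ae_eq_refl.
Qed.

(** Elements of the cone coincide with their rearrangements, and a sum of decreasing functions is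
    decreasing, so both sides integrate the same function. *)
Lemma cone_add x y : cone x -> cone y ->
  cone (x + y) /\ forall t, 0 <= t -> primR (x + y) t = primR x t + primR y t.
Proof.
move=> cx cy; pose w t := (rearr (ev x) t + rearr (ev y) t)%E.
have w0 s : dom s -> (0 <= w s)%E by move=> _; rewrite adde_ge0 ?rearr_ge0.
have dw s t : dom s -> dom t -> s <= t -> (w t <= w s)%E.
  by move=> _ _ st; rewrite leeD ?rearr_noninc.
have xyw : eqE (ev (x + y)) w.
  apply: filterS3 (bfs_add hb x y) (iffLR (coneP x) cx) (iffLR (coneP y) cy).
  by move=> t h1 h2 h3 dt; rewrite h1// h2// h3.
split; first by have [] := cone_rep w0 dw xyw.
move=> t t0; have := prim_cone w0 dw xyw t0.
have mdt : measurable (dom `&` `[0%R, t]%classic).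
  by apply: measurableI => //; exact: measurable_itv.
rewrite ge0_integralD//; try exact: measurable_rearr; last 2 first.
- by move=> *; exact: rearr_ge0.
- by move=> *; exact: rearr_ge0.
rewrite -(prim_dom x t0) -(prim_dom y t0) (primE x t0) (primE y t0) (primE _ t0).
exact: EFin_inj.
Qed.

Lemma cone_scale c x : 0 <= c -> cone x ->
  cone (c *: x) /\ forall t, 0 <= t -> primR (c *: x) t = c * primR x t.
Proof.
move=> c0 cx; pose w t := (c%:E * rearr (ev x) t)%E.
have w0 s : dom s -> (0 <= w s)%E by move=> _; rewrite mule_ge0 ?rearr_ge0.
have dw s t : dom s -> dom t -> s <= t -> (w t <= w s)%E.
  by move=> _ _ st; rewrite lee_wpmul2l ?rearr_noninc.
have xw : eqE (ev (c *: x)) w.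
  apply: filterS2 (bfs_scale hb c x) (iffLR (coneP x) cx).
  by move=> t h1 h2 dt; rewrite h1// h2.
split; first by have [] := cone_rep w0 dw xw.
move=> t t0; have := prim_cone w0 dw xw t0.
have mdt : measurable (dom `&` `[0%R, t]%classic).
  by apply: measurableI => //; exact: measurable_itv.
rewrite ge0_integralZl_EFin//; last 2 first.
- by move=> *; exact: rearr_ge0.
- exact: measurable_rearr.
rewrite -(prim_dom x t0) (primE x t0) (primE _ t0); exact: EFin_inj.
Qed.

Lemma cone0 : cone 0.
Proof.
have [e _] := chi_half; have [xs [_ _ cxs _]] := rearr_elem e.
by have [] := cone_scale (lexx 0) cxs; rewrite scale0r.
Qed.

Lemma primR0 t : 0 <= t -> primR 0 t = 0.
Proof.
by move=> t0; have [_ /(_ t t0)] := cone_scale (lexx 0) cone0; rewrite scaler0 mul0r.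
Qed.

Lemma cone_sum (I : Type) (r : seq I) (F : I -> E) : (forall i, cone (F i)) ->
  cone (\sum_(i <- r) F i) /\
  forall t, 0 <= t -> primR (\sum_(i <- r) F i) t = \sum_(i <- r) primR (F i) t.
Proof.
move=> cF; elim: r => [|i r [IH1 IH2]].
  by split=> [|t t0]; rewrite !big_nil; [exact: cone0|exact: primR0].
rewrite big_cons; have [h1 h2] := cone_add (cF i) IH1.
by split => // t t0; rewrite h2// IH2// big_cons.
Qed.

(** On the cone the pointwise bound [ev x <= ev y + |ev (x - y)|] is a bound between rearrangements;
    the integral of the last term is controlled by [integral_abs_le_rearr] and [prim_le_norm]. *)
Lemma primR_lipschitz : exists K : R -> R, (forall t, 0 <= t -> 0 <= K t) /\
  (forall x t, 0 <= t ->
    (\int[mu]_(s in dom `&` `[0%R, t]) `|ev x s| <= (K t * `|x|)%:E)%E) /\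
  forall x y t, cone x -> cone y -> 0 <= t -> primR x t <= primR y t + K t * `|x - y|.
Proof.
have [K [K0 hK]] := prim_le_norm.
have h1 x t : 0 <= t ->
    (\int[mu]_(s in dom `&` `[0%R, t]) `|ev x s| <= (K t * `|x|)%:E)%E.
  by move=> t0; apply: le_trans (integral_abs_le_rearr _ t0) (hK x t t0).
exists K; split => //; split => // x y t cx cy t0.
have mdt : measurable (dom `&` `[0%R, t]%classic).
  by apply: measurableI => //; exact: measurable_itv.
suff : (prim (ev x) t <= prim (ev y) t +
    \int[mu]_(s in dom `&` `[0%R, t]) `|ev (x - y)%R s|)%E.
  move=> h; have := le_trans h (leeD2l _ (h1 _ _ t0)).
  by rewrite (primE x t0) (primE y t0).
rewrite (prim_dom x t0) (prim_dom y t0).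
have ma : measurable_fun (dom `&` `[0%R, t]%classic) (fun s => `|ev (x - y)%R s|%E).
  apply: (@measurable_funS _ _ _ _ dom) => //.
  by apply: measurableT_comp; [exact: abse_measurable|].
rewrite -ge0_integralD//; last 2 first.
- by move=> *; exact: rearr_ge0.
- exact: measurable_rearr.
apply: ae_ge0_le_integral => //.
- by move=> *; exact: rearr_ge0.
- exact: measurable_rearr.
- by move=> *; rewrite adde_ge0 ?rearr_ge0.
- by apply: emeasurable_funD => //; exact: measurable_rearr.
apply: filterS3 (ev_sub x y) (iffLR (coneP x) cx) (iffLR (coneP y) cy).
move=> s h2 h3 h4 [ds _]; rewrite h2// h3// h4//.
have := rearr_ge0 (ev x) s; have := rearr_ge0 (ev y) s.
case: (rearr (ev x) s) => [a| |]; case: (rearr (ev y) s) => [b| |]//= _ _;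
  rewrite ?leey// lee_fin; have := ler_norm (a - b); lra.
Qed.

(* The sequence converges almost everywhere because the norms are summable, and
   the lower limit of decreasing functions is decreasing. *)
Lemma cone_cvg (c : nat -> E) w : (forall j, cone (c j)) ->
  (forall j, `|c j - w| <= 1 / (2 ^ j.+1)%:R) -> cone w.
Proof.
move=> cc cw.
have [K [K0 [hK _]]] := primR_lipschitz.
have mdN (N : nat) : measurable (dom `&` `[0%R, N%:R]%classic).
  by apply: measurableI => //; exact: measurable_itv.
have md j (D : set R) : D `<=` dom -> measurable_fun D (fun s => `|ev (c j - w)%R s|%E).
  move=> Dd; apply: (@measurable_funS _ _ _ _ dom) => //.
  by apply: measurableT_comp; [exact: abse_measurable|].
(* Norms control integrals only over bounded intervals, so the series is summed on each [[0, N]]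
   separately, with total integral at most [K N]. *)
have hfin : {ae mu, forall s (N : nat), (dom `&` `[0%R, N%:R]) s ->
    (\sum_(j <oo) `|ev (c j - w)%R s| < +oo)%E}.
  apply: ae_foralln => N.
  have : mu.-integrable (dom `&` `[0%R, N%:R]%classic)
      (fun s => \sum_(j <oo) `|ev (c j - w)%R s|)%E.
    apply/integrableP; split.
      apply: ge0_emeasurable_sum => //; first by move=> j _; apply: md => s [].
    under eq_integral do rewrite gee0_abs ?nneseries_ge0//.
    rewrite integral_nneseries//; [|exact: mdN|by move=> j; apply: md => s []].
    apply: (@le_lt_trans _ _ (\sum_(j <oo) (K N%:R)%:E * (1 / (2 ^ j.+1)%:R)%:E)%E).
      apply: lee_nneseries; first by move=> j _ _; exact: integral_ge0.
      move=> j _; apply: (le_trans (hK _ _ (ler0n _ _))); rewrite -EFinM lee_fin.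
      by apply: ler_wpM2l; [exact: K0|exact: cw].
    rewrite nneseriesZl; last by move=> *; rewrite lee_fin divr_ge0.
    apply: (@le_lt_trans _ _ ((K N%:R)%:E * 1%:E)%E); last by rewrite -EFinM ltry.
    by apply: lee_wpmul2l; [rewrite lee_fin K0|exact: epsilon_trick0].
  move=> hi; have := @integrable_ae _ _ R mu _ (mdN N) _ hi; apply: filterS => s h /h.
  by rewrite fin_numElt => /andP[].
have hsub : {ae mu, forall s (j : nat), dom s ->
    ev (c j - w) s = (ev (c j) s - ev w s)%E}.
  by apply: ae_foralln => j; exact: ev_sub.
have hcone : {ae mu, forall s (j : nat), dom s -> ev (c j) s = rearr (ev (c j)) s}.
  by apply: ae_foralln => j; apply/coneP.
have hfinc : {ae mu, forall s (j : nat), dom s -> ev (c j) s \is a fin_num}.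
  by apply: ae_foralln => j; exact: ev_fin.
have hfinw := ev_fin w.
pose f s := limn_einf (fun j => rearr (ev (c j)) s).
have wf : eqE (ev w) f.
  near=> s => ds.
  have h1 : forall (N : nat), (dom `&` `[0%R, N%:R]) s ->
    (\sum_(j <oo) `|ev (c j - w)%R s| < +oo)%E by near: s.
  have h2 : forall (j : nat), dom s -> ev (c j - w) s = (ev (c j) s - ev w s)%E by near: s.
  have h3 : forall (j : nat), dom s -> ev (c j) s = rearr (ev (c j)) s by near: s.
  have h4 : forall (j : nat), dom s -> ev (c j) s \is a fin_num by near: s.
  have h5 : dom s -> ev w s \is a fin_num by near: s.
  apply/esym; rewrite /f.
  suff /cvg_limn_einf_sup[] : (fun j => rearr (ev (c j)) s) @ \oo --> ev w s by [].
  rewrite (_ : (fun j => _) = fun j => ev (c j) s); last by apply/funext => j; rewrite h3.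
  have hN := h1 (Num.bound s).
  have : (\sum_(j <oo) `|ev (c j - w)%R s| < +oo)%E.
    apply: hN; split => //=; rewrite in_itv/=; have s0 : 0 <= s by case: ds.
    by rewrite s0 ltW// archi_boundP.
  move=> /nneseries_tail_cvg/(_ (fun _ _ => abse_ge0 _)) htail.
  rewrite -(fineK (h5 ds)); apply/fine_cvgP; split; first by apply: nearW => j; exact: h4.
  move/fine_cvgP : htail => [tfin /cvgrPdist_lt tcvg].
  apply/cvgrPdist_lt => e e0; have {}tcvg := tcvg e e0.
  near=> j.
  have tj : (\sum_(j <= k <oo) `|ev (c k - w)%R s|)%E \is a fin_num by near: j.
  have tje : `|0 - fine (\sum_(j <= k <oo) `|ev (c k - w)%R s|)%E| < e by near: j.
  apply: le_lt_trans tje; rewrite sub0r normrN.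
  apply: le_trans (ler_norm _); rewrite -lee_fin fineK//.
  have := @nneseries_lim_ge R (fun k => `|ev (c k - w)%R s|%E) xpredT j j.+1
    (fun _ _ _ => abse_ge0 _).
  apply: le_trans; rewrite big_nat1 h2//.
  rewrite /=; case: (ev (c j) s) (h4 j ds) => // a _; case: (ev w s) (h5 ds) => // b _ /=.
  by rewrite lee_fin distrC.
have f0 s : dom s -> (0 <= f s)%E.
  move=> _; rewrite /f limn_einf_lim; apply: lime_ge; first exact: is_cvg_einfs.
  by apply: nearW => n; apply: le_ereal_inf_tmp => _ [j _ <-]; exact: rearr_ge0.
have df s t : dom s -> dom t -> s <= t -> (f t <= f s)%E.
  move=> _ _ st; rewrite /f !limn_einf_lim; apply: lee_lim; try exact: is_cvg_einfs.
  apply: nearW => n; apply: le_ereal_inf_tmp => _ [j jn <-].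
  apply: le_trans (rearr_noninc (ev (c j)) st).
  by apply: ereal_inf_lbound; exists j.
by have [] := cone_rep f0 df wf.
Unshelve. all: by end_near. Qed.

(** * Compactness from full rotundity *)

(** Passage to the limit in an inequality, at the rate provided by [cluster_subseq]. *)
Lemma le_add_geometric (a b c : R) (n : nat) : 0 <= c ->
  (forall j, (n <= j)%N -> a <= b + c * (1 / (2 ^ j.+1)%:R)) -> a <= b.
Proof.
move=> c0 h; apply/ler_addgt0Pr => e e0.
pose j := maxn n (Num.bound (c / e)).
apply: le_trans (h j (leq_maxl _ _)) _; rewrite lerD2l mul1r.
rewrite ler_pdivrMr ?ltr0n ?expn_gt0// mulrC -ler_pdivrMr//.
have h1 := archi_boundP (divr_ge0 c0 (ltW e0)).
apply: (le_trans (ltW h1)); rewrite ler_nat.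
apply: (@leq_trans j.+1); last exact/ltnW/ltn_expl.
by rewrite ltnW// ltnS leq_maxr.
Qed.

(** The indices need not increase: [j <= psi j] suffices for limits, and the rate is the summable
    one that [cone_cvg] expects. *)
Lemma cluster_subseq (u : nat -> E) w : cluster (u @ \oo) w ->
  exists psi : nat -> nat, forall j,
    (j <= psi j)%N /\ `|u (psi j) - w| <= 1 / (2 ^ j.+1)%:R.
Proof.
move=> cw; suff /choice : forall j, exists m : nat,
  (j <= m)%N /\ `|u m - w| <= 1 / (2 ^ j.+1)%:R by case=> psi hpsi; exists psi.
move=> j; have e0 : 0 < 1 / (2 ^ j.+1)%:R :> R by rewrite divr_gt0// ltr0n expn_gt0.
have [] := cw [set u m | m in [set m | (j <= m)%N]] (ball w (1 / (2 ^ j.+1)%:R)).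
- by exists j => //= m jm; exists m.
- exact: nbhsx_ballx.
move=> _ [[m jm <-]]; rewrite -ball_normE /= => h; exists m; split => //.
by rewrite distrC ltW.
Qed.

(** If [u n] left a neighbourhood [U] of [p] infinitely often, the sequence restricted to those
    indices would cluster somewhere in [K], necessarily at [p], although it avoids [U]. *)
Lemma cvg_unique_cluster (u : nat -> E) (K : set E) p : compact K ->
  (\forall n \near \oo, K (u n)) -> (forall w, cluster (u @ \oo) w -> w = p) ->
  u @ \oo --> p.
Proof.
move=> cK uK hp U Up; apply: contrapT => nU.
pose G := within (~` U) (u @ \oo).
have pG : ProperFilter G.
  apply: Build_ProperFilter_ex => A GA; apply: contrapT => nA; apply: nU.
  suff : \forall n \near \oo, U (u n) by [].
  have {}GA : \forall n \near \oo, ((~` U) (u n) -> A (u n)) by [].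
  apply: filterS GA => n /= h; apply: contrapT => nUn; apply: nA.
  by exists (u n); exact: h.
have GK : G K.
  suff : \forall n \near \oo, ((~` U) (u n) -> K (u n)) by [].
  by apply: filterS uK => n /= Kn _.
have [q [Kq cq]] := cK G pG GK.
have qp : q = p.
  apply: hp => A B FA; apply: cq.
  suff : \forall n \near \oo, ((~` U) (u n) -> A (u n)) by [].
  by apply: filterS (FA : \forall n \near \oo, A (u n)) => n /= ? _.
have [||x []] := cq (~` U) U; [|by rewrite qp|by []].
suff : \forall n \near \oo, ((~` U) (u n) -> (~` U) (u n)) by [].
exact: nearW.
Qed.

Variable k : nat.
Hypothesis hk : (2 <= k)%N.
Hypothesis hrot : compactly_fully_rotund_on k cone.

(** Since [|u n| --> l], sums of [k] of the unit vectors [v n] have nearly [1 / l] times the norm of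
    the corresponding sums of [u], so the bound by [r] makes rotundity applicable to [v].
    Compactness returns to [u] through multiplication by scalars in [[0, l + l]]. *)
Lemma rotund_compact (u : nat -> E) (r : nat -> R) (l : R) : 0 < l ->
  (forall n, cone (u n)) -> `|u n| @[n --> \oo] --> l -> r n @[n --> \oo] --> l ->
  (forall n (phi : 'I_k -> nat), (forall i, (n <= phi i)%N) ->
     k%:R * r n <= `|\sum_(i < k) u (phi i)|) ->
  exists2 K : set E, compact K & \forall n \near \oo, K (u n).
Proof.
move=> l0 cu ul rl hr.
have [N _ hN] : \forall n \near \oo, 0 < `|u n| < l + l.
  have h1 := cvgr_gt l ul _ l0.
  have h2 := cvgr_lt l ul _ (ltr_pwDl l0 (lexx l)).
  by apply: filterS2 (h1 _) (h2 _) => n -> ->.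
pose v n := `|u (n + N)%N|^-1 *: u (n + N)%N.
have uN n : 0 < `|u (n + N)%N| by have /andP[] := hN _ (leq_addl n N).
have vu n : `|u (n + N)%N| *: v n = u (n + N)%N.
  by rewrite scalerA divff ?scale1r// gt_eqF.
have v1 n : `|v n| = 1 by rewrite normrZ normfV normr_id mulVf// gt_eqF.
have : precompact (range v).
  apply: hrot => [n|phi hphi].
    split; last exact: v1.
    by apply: (@cone_scale _ _ _ (cu (n + N)%N)).1; rewrite invr_ge0 ltW.
  have phin i n : (n <= phi i n)%N.
    elim: n => // n IH; apply: leq_ltn_trans IH _; exact: hphi.
  apply/cvgrPdist_le => e e0.
  have k0 : 0 < k%:R :> R by rewrite ltr0n (leq_trans _ hk).
  (* Two errors of size [k * d] arise, from replacing [u] by [l *: v] and [r] by [l]; together they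
     equal [l * e]. *)
  pose d := l * e / (2 * k%:R).
  have d0 : 0 < d by rewrite /d divr_gt0 ?mulr_gt0.
  have [M1 _ hM1] := (cvgrPdist_le _ _).1 ul d d0.
  have [M2 _ hM2] := (cvgrPdist_le _ _).1 rl d d0.
  exists (maxn M1 M2) => // n /=; rewrite geq_max => /andP[M1n M2n].
  set s := \sum_(i < k) _.
  have sk : `|s| <= k%:R.
    apply: (le_trans (ler_norm_sum _ _ _)).
    rewrite (eq_bigr (fun=> 1)) => [|i _]; last exact: v1.
    by rewrite sumr_const card_ord.
  rewrite ger0_norm ?subr_ge0//.
  pose S' := \sum_(i < k) u (phi i n + N)%N.
  have hS : k%:R * r (n + N)%N <= `|S'|.
    by apply: (hr _ (fun i => phi i n + N)%N) => i; rewrite leq_add2r.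
  have hd : `|S' - l *: s| <= k%:R * d.
    rewrite /S' /s scaler_sumr -sumrB (le_trans (ler_norm_sum _ _ _))//.
    apply: (@le_trans _ _ (\sum_(i < k) d)); last by rewrite sumr_const card_ord mulr_natl.
    apply: ler_sum => i _; rewrite -{1}vu -scalerBl normrZ v1 mulr1 distrC.
    apply: hM1 => /=; apply: (leq_trans M1n); apply: (leq_trans (phin i n)).
    exact: leq_addr.
  have h2 : l - d <= r (n + N)%N.
    have := hM2 (n + N)%N (leq_trans M2n (leq_addr _ _)); rewrite ler_norml => /andP[_].
    by lra.
  have h3 : `|S'| <= k%:R * d + l * `|s|.
    have := ler_normD (S' - l *: s) (l *: s); rewrite subrK normrZ (gtr0_norm l0) => h.
    by apply: (le_trans h); rewrite lerD2r.
  have h4 : k%:R * (l - d) <= k%:R * d + l * `|s|.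
    by apply: le_trans h3; apply: le_trans hS; rewrite ler_pM2l.
  have h5 : l * (k%:R - `|s|) <= l * e.
    have -> : l * e = k%:R * d + k%:R * d.
      by rewrite /d; field; rewrite gt_eqF.
    by rewrite mulrBr; move: h4; rewrite mulrBr; lra.
  by rewrite ler_pM2l in h5.
rewrite precompactE => cK.
pose K := (fun p : R * E => p.1 *: p.2) @` (`[0, l + l]%classic `*` closure (range v)).
exists K.
  apply: continuous_compact.
    by apply: continuous_subspaceT => p; exact: scale_continuous.
  by apply: compact_setX => //; exact: segment_compact.
exists N => // n /= Nn; exists (`|u n|, v (n - N)%N); last first.
  by rewrite /= -{1}[n](subnK Nn) vu subnK.
split => /=; last by apply: subset_closure; exists (n - N)%N.
by rewrite in_itv/= normr_ge0/=; have /andP[_ /ltW] := hN _ Nn.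
Unshelve. all: by end_near. Qed.

Lemma cluster_cone (u : nat -> E) w : (forall n, cone (u n)) ->
  cluster (u @ \oo) w -> cone w.
Proof.
move=> cu /cluster_subseq[psi hpsi].
by apply: (@cone_cvg (u \o psi)) => j /=; [exact: cu|exact: (hpsi j).2].
Qed.

Lemma cluster_primR_le (u : nat -> E) w t (b : R) : (forall n, cone (u n)) ->
  cluster (u @ \oo) w -> 0 <= t -> (forall n, primR (u n) t <= b) -> primR w t <= b.
Proof.
move=> cu cw t0 ub; have wc := cluster_cone cu cw.
have [psi hpsi] := cluster_subseq cw.
have [K [K0 [_ hK]]] := primR_lipschitz.
apply: (@le_add_geometric _ _ (K t) 0) => [|j _]; first exact: K0.
apply: le_trans (hK _ _ _ wc (cu (psi j)) t0) _.
rewrite lerD// ler_wpM2l ?K0// distrC; exact: (hpsi j).2.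
Qed.

Lemma cluster_primR_ge (u : nat -> E) w t (b : R) N : (forall n, cone (u n)) ->
  cluster (u @ \oo) w -> 0 <= t -> (forall n, (N <= n)%N -> b <= primR (u n) t) -> b <= primR w t.
Proof.
move=> cu cw t0 ub; have wc := cluster_cone cu cw.
have [psi hpsi] := cluster_subseq cw.
have [K [K0 [_ hK]]] := primR_lipschitz.
apply: (@le_add_geometric _ _ (K t) N) => [|j Nj]; first exact: K0.
apply: le_trans (ub (psi j) _) _; first by apply: leq_trans Nj _; exact: (hpsi j).1.
apply: le_trans (hK _ _ _ (cu (psi j)) wc t0) _.
by rewrite lerD// ler_wpM2l ?K0//; exact: (hpsi j).2.
Qed.

Lemma cluster_norm (u : nat -> E) w (l : R) : `|u n| @[n --> \oo] --> l ->
  cluster (u @ \oo) w -> `|w| = l.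
Proof.
move=> ul /cluster_subseq[psi hpsi].
apply/eqP; rewrite -subr_eq0 -normr_le0; apply/ler_addgt0Pr => e e0.
rewrite add0r; have [N _ hN] := (cvgrPdist_le _ _).1 ul e e0.
apply: (@le_add_geometric _ _ 1 N) => // j Nj.
have h1 := hN (psi j) (leq_trans Nj (hpsi j).1).
have h2 := le_trans (ler_dist_dist (u (psi j)) w) (hpsi j).2.
rewrite -(subrK `|u (psi j)| `|w|) -addrA (le_trans (ler_normD _ _))//.
rewrite distrC in h1; rewrite distrC in h2.
by rewrite mul1r [leRHS]addrC lerD.
Qed.

Lemma submaj_cvg (u : nat -> E) (l : R) : 0 < l -> (forall n, cone (u n)) ->
  (forall n t, 0 < t -> primR (u n) t <= primR (u n.+1) t) ->
  `|u n| @[n --> \oo] --> l ->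
  exists y, [/\ cone y, u @ \oo --> y & forall n t, 0 < t -> primR (u n) t <= primR y t].
Proof.
move=> l0 cu hu ul.
have mono n m t : 0 < t -> (n <= m)%N -> primR (u n) t <= primR (u m) t.
  move=> t0; elim: m => [|m IH]; first by rewrite leqn0 => /eqP ->.
  by rewrite leq_eqVlt => /predU1P[->//|/IH h]; apply: (le_trans h); exact: hu.
have [K cK uK] : exists2 K : set E, compact K & \forall n \near \oo, K (u n).
  apply: (rotund_compact l0 cu ul ul) => n phi hphi.
  have [cs hs] := cone_sum (index_enum 'I_k) (fun i => cu (phi i)).
  have [ck hk'] := cone_scale (ler0n R k) (cu n).
  rewrite -[k%:R]ger0_norm// -normrZ; apply: kmono_primR => t t0.
  rewrite hs ?hk' ?(ltW t0)// mulr_natl -[X in _ *+ X]card_ord -sumr_const.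
  by apply: ler_sum => i _; exact: mono.
have [p [_ cp]] := cK (u @ \oo) _ uK.
have ge w n t : cluster (u @ \oo) w -> 0 < t -> primR (u n) t <= primR w t.
  move=> cw t0; apply: (@cluster_primR_ge u w t _ n cu cw (ltW t0)) => m nm; exact: mono.
(* Every [primR (u n) t] lies below the value at [w'], and the value at [w] is a limit of such
   numbers; exchanging [w] and [w'] gives equality. *)
have le w w' t : cluster (u @ \oo) w -> cluster (u @ \oo) w' -> 0 < t -> primR w t <= primR w' t.
  by move=> cw cw' t0; apply: (cluster_primR_le cu cw (ltW t0)) => n; exact: ge.
exists p; split; [exact: cluster_cone cp| |by move=> n t; exact: ge].
apply: (cvg_unique_cluster cK uK) => w cw.
apply: strict_mono_primR; [exact: cluster_cone cw|exact: cluster_cone cp| |].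
  by move=> t; exact: le.
by apply: kmono_primR => t; exact: le.
Qed.

Lemma primR_le_ae x y t : 0 <= t ->
  {ae mu, forall s, dom s -> (`|ev x s| <= `|ev y s|)%E} -> primR x t <= primR y t.
Proof.
move=> t0 xy; suff : (prim (ev x) t <= prim (ev y) t)%E.
  by rewrite (primE x t0) (primE y t0).
by apply: prim_le_rearr => s; exact: rearr_le_ae.
Qed.

(* Otherwise, for alpha = +oo, the indicators of [[0, n)] form a bounded increasing
   sequence in E^d whose consecutive differences have constant norm. *)
Lemma rearr_infinity y (c : R) : cone y -> 0 < c -> exists2 T, 0 < T & rearrR y T < c.
Proof.
move=> cy c0; case: halpha => ha.
  exists 1 => //; rewrite -lte_fin -rearrE// rearr_off// => -[_].
  by rewrite ha ltxx.
apply: contrapT => nT.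
have yT t : 0 < t -> c <= rearrR y t.
  by move=> t0; rewrite leNgt; apply/negP => h; apply: nT; exists t.
have yT' t : 0 <= t -> (c%:E <= rearr (ev y) t)%E.
  move=> t0; apply: (@le_trans _ _ (rearr (ev y) (t + 1))).
    by rewrite rearrE ?ltr_wpDl// lee_fin yT// ltr_wpDl.
  by apply: rearr_noninc; rewrite lerDl.
have /choice[u hu] := fun n : nat => chi_mem n.+1%:R.
have cu n : cone (u n).
  by apply: (cone_rep _ _ (hu n)).1 => *; [exact: chi_ge0|exact: chi_decr].
have abs_le n m : (n <= m)%N -> {ae mu, forall s, dom s -> (`|ev (u n) s| <= `|ev (u m) s|)%E}.
  move=> nm; apply: filterS2 (hu n) (hu m) => s h1 h2 ds.
  rewrite h1// h2// !gee0_abs ?chi_ge0// lee_fin ler_nat.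
  by case: (ltP s n.+1%:R) => // sn; rewrite (lt_le_trans sn)// ler_nat.
have bnd n : `|u n| <= `|y| / c.
  rewrite ler_pdivlMr// mulrC -{1}(gtr0_norm c0) -normrZ; apply: norm_le.
  apply: filterS3 (hu n) (bfs_scale hb c (u n)) (iffLR (coneP y) cy) => s h1 h2 h3 ds.
  rewrite h2// h1// h3// gee0_abs ?mule_ge0 ?chi_ge0 ?lee_fin ?(ltW c0)//.
  rewrite gee0_abs ?rearr_ge0//; have s0 : 0 <= s by case: ds.
  apply: le_trans (yT' _ s0); rewrite /chi; case: ltP => _; first by rewrite mule1.
  by rewrite mule0 lee_fin ltW.
have ndn : nondecreasing_seq (fun n => `|u n|).
  by move=> n m nm; apply: norm_le; exact: abs_le.
have u0 : 0 < `|u 0%N| by exact: chi_norm_gt0 (hu 0%N).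
have [l ul] : exists l, `|u n| @[n --> \oo] --> l.
  exists (limn (fun n => `|u n|)).
  apply: nondecreasing_is_cvgn => //.
  by exists (`|y| / c) => _ [n _ <-].
have l0 : 0 < l.
  apply: (lt_le_trans u0); rewrite -(cvg_lim _ ul)//.
  apply: nondecreasing_cvgn_le => //.
  by apply/cvg_ex; exists l.
have [n t t0|p [_ up _]] := submaj_cvg l0 cu _ ul.
  by apply: primR_le_ae (ltW t0) _; exact: abs_le.
have [N _ hN] := (cvgrPdist_lt _ _).1 up _ (divr_gt0 u0 (ltr0n _ 2)).
(* Convergence makes consecutive terms closer than [|u 0|], but their difference is the indicator of
   [[N+1, N+2)], a translate of [u 0]. *)
suff : `|u 0%N| <= `|u N.+1 - u N|.
  have h1 := hN N (leqnn _); have h2 := hN N.+1 (leqnSn _).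
  have h3 := ler_distD p (u N.+1) (u N).
  by rewrite distrC in h2; move: h1 h2 h3 => /=; lra.
pose f (s : R) := (chi N.+2%:R s - chi N.+1%:R s)%E.
have mf : measurable_fun dom f.
  by apply: emeasurable_funB; exact: measurable_chi.
have df : eqE (ev (u N.+1 - u N)) f.
  apply: filterS3 (hu N.+1) (hu N) (ev_sub (u N.+1) (u N)) => s h1 h2 h3 ds.
  by rewrite h3// h1// h2.
have mi : measurable (`[N.+1%:R, N.+2%:R[%classic : set R) by exact: measurable_itv.
apply: kmono => t _; apply: prim_le_rearr => s.
rewrite (rearr_ev_eqE mf df) (rearr_ev_eqE (measurable_chi _) (hu 0%N)).
apply: rearr_le_distr => r r0; have [r1|r1] := ltP r 1; last first.
  rewrite [X in (X <= _)%E](_ : _ = 0%E) ?distr_ge0//.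
  rewrite /Defs.distr [X in mu X](_ : _ = set0) ?measure0//.
  apply/seteqP; split => // v [_ /=]; rewrite lte_fin.
  by case: (v < 1)%R; rewrite ltNge ?normr1 ?normr0 ?r1 ?(ltW r0).
apply: (@le_trans _ _ (mu `[N.+1%:R, N.+2%:R[%classic)).
  apply: (@le_trans _ _ (mu `[0%R, 1%R[%classic)).
    apply: mu_le; [by apply: measurable_level; exact: measurable_chi|exact: measurable_itv|].
    move=> v [[v0 _] /=]; rewrite lte_fin in_itv/= v0.
    by case: (v < 1)%R => //=; rewrite normr0 ltNge (ltW r0).
  rewrite !lebesgue_measure_itv/= !lte_fin ltr01 ltr_nat ltnSn sube0 lee_fin.
  by rewrite -natrB// subSnn.
apply: mu_le => //; first exact: measurable_level.
move=> v /=; rewrite in_itv/= => /andP[v1 v2]; split.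
  by split; [exact: le_trans v1|rewrite ha ltry].
have nv1 : (v < N.+1%:R) = false by apply/negbTE; rewrite -leNgt.
by rewrite /= v2 nv1 subr0 normr1 lte_fin.
Qed.

(** * Lower bounds for nearly norming minorants *)

(** The slope of [primR y] may be unbounded near 0; cutting the argument off at [a] makes it
    Lipschitz with constant [rearrR y a], and the 1 added in [C] only ensures positivity. *)
Lemma primR_continuous y (a : R) : 0 < a -> continuous (fun u => primR y (Num.max a u)).
Proof.
move=> a0 u; apply/cvgrPdist_lt => e e0.
pose C := rearrR y a + 1; have C0 : 0 < C by rewrite ltr_wpDl// rearrR_ge0.
have lip s s' : a <= s -> s <= s' -> primR y s' - primR y s <= C * (s' - s).
  move=> as_ ss'; have s0 := lt_le_trans a0 as_.
  have := primR_upper y s0 ss'.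
  have : rearrR y s <= rearrR y a.
    by rewrite -lee_fin -!rearrE// rearr_noninc.
  have := ler_wpM2l (_ : 0 <= s' - s) (_ : rearrR y s <= C).
  rewrite subr_ge0 => h1 h2 h3.
  have := h1 ss' (le_trans h2 _); rewrite /C lerDl ler01 => /(_ isT) h4.
  by rewrite mulrC; lra.
near=> v.
have uv : `|u - v| < e / C by near: v; apply: cvgr_dist_lt; rewrite ?divr_gt0//; exact: cvg_id.
have key s s' : `|s - s'| < e / C -> s <= s' ->
    `|primR y (Num.max a s) - primR y (Num.max a s')| < e.
  move=> h ss'; have mm : Num.max a s <= Num.max a s' by rewrite ge_max !le_max lexx/= ss' orbT.
  have ms : a <= Num.max a s by rewrite le_max lexx.
  rewrite distrC ger0_norm; last by rewrite subr_ge0 primR_le// (le_trans (ltW a0)).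
  apply: (le_lt_trans (lip _ _ ms mm)).
  apply: (@le_lt_trans _ _ (C * `|s - s'|)).
    rewrite ler_pM2l// distrC ger0_norm ?subr_ge0//.
    by rewrite /Num.max; case: (ltP a s); case: (ltP a s') => h1 h2; lra.
  by rewrite mulrC -ltr_pdivlMr.
have [uv'|vu] := leP u v; first exact: key.
by rewrite distrC; apply: key (ltW vu); rewrite distrC.
Unshelve. all: by end_near. Qed.

(* The line through [(t, primR y t)] with slope [nu] lies below [primR y] exactly
   on [[t, b]], where [b] may be the right end of the domain. *)
Lemma tangent_exit y (t nu : R) : cone y -> 0 < t -> dom t -> 0 < nu -> nu < rearrR y t ->
  exists s1 b, [/\ t < s1 <= b, (b%:E <= alpha)%E, primR y t + nu * (s1 - t) < primR y s1,
    primR y t + nu * (b - t) <= primR y b &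
    (b%:E < alpha)%E -> primR y b = primR y t + nu * (b - t)].
Proof.
move=> cy t0 dt nu0 nut.
(* In terms of [distr], [nu < rearr (ev y) t] is the open condition [t < distr (ev y) nu], so it
   persists at some [s1 > t]; hence [primR y] is strictly above the line at [s1]. *)
have [s1 ts1 s1d] : exists2 s1, t < s1 & (s1%:E < distr (ev y) nu)%E.
  have : (t%:E < distr (ev y) nu)%E.
    by rewrite -rearr_gt// ?ltW// rearrE// lte_fin.
  case: (distr _ _) => [d| |]//.
    rewrite lte_fin => td; exists ((t + d) / 2); rewrite ?lte_fin; lra.
  by exists (t + 1); rewrite ?ltry// ltrDl.
have s10 : 0 < s1 by exact: lt_trans ts1.
have s1a : (s1%:E < alpha)%E by exact: lt_le_trans s1d (distr_le_alpha _ (ev_meas y)).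
have nus1 : nu < rearrR y s1.
  by rewrite -lte_fin -rearrE// rearr_gt// ltW.
pose D s := primR y s - (primR y t + nu * (s - t)).
have D1 : 0 < D s1.
  have h1 := primR_lower y (ltW t0) ts1.
  have : nu * (s1 - t) < (s1 - t) * rearrR y s1 by rewrite mulrC ltr_pM2l// subr_gt0.
  by rewrite /D subr_gt0; lra.
have ivt s2 : s1 <= s2 -> (s2%:E <= alpha)%E -> D s2 <= 0 ->
    exists2 b, s1 <= b & (b%:E <= alpha)%E /\ D b = 0.
  move=> s12 s2a D2.
  pose g u := primR y (Num.max s1 u) - (primR y t + nu * (u - t)).
  have cg : continuous g.
    move=> u; apply: cvgB; first exact: primR_continuous.
    apply: cvgD; first exact: cvg_cst.
    by apply: cvgMr; apply: cvgB; [exact: cvg_id|exact: cvg_cst].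
  have gD u : s1 <= u -> g u = D u by move=> su; rewrite /g max_r.
  have [||b] := @IVT R g s1 s2 0 s12.
  - exact: continuous_subspaceT.
  - by rewrite !gD// ge_min le_max D2 (ltW D1) orbT.
  rewrite in_itv/= => /andP[sb bs]; rewrite gD// => Db.
  by exists b => //; split => //; apply: le_trans s2a; rewrite lee_fin.
suff [b [s1b ba Db Db']] : exists b, [/\ s1 <= b, (b%:E <= alpha)%E, 0 <= D b &
    (b%:E < alpha)%E -> D b = 0].
  exists s1, b; split => //; first by rewrite ts1.
  - by rewrite -subr_gt0.
  - by rewrite -subr_ge0.
  - by move=> /Db'/eqP; rewrite subr_eq0 => /eqP.
case: halpha => ha.
  have s11 : s1 <= 1 by rewrite -lee_fin -ha ltW.
  have [D2|D2] := leP (D 1) 0.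
    have [|b s1b [ba Db]] := ivt 1 s11 _ D2; first by rewrite ha.
    by exists b; split => //; rewrite Db.
  by exists 1; split; rewrite ?ha ?ltxx// ltW.
have [T T0 hT] := @rearr_infinity y (nu / 2) cy (divr_gt0 nu0 (ltr0n _ 2)).
(* Beyond [T] the slope of [primR y] is below [nu / 2], whence
   [D s2 <= primR y T + nu * t - nu * s2 / 2]; the last summand of [s2] makes this nonpositive. *)
pose s2 := Num.max T s1 + 2 * (primR y T + nu * t) / nu.
have q0 : 0 <= 2 * (primR y T + nu * t) / nu.
  by rewrite divr_ge0 ?(ltW nu0)// mulr_ge0// addr_ge0 ?primR_ge0// mulr_ge0 ?ltW.
have Tm : T <= Num.max T s1 by rewrite le_max lexx.
have s1m : s1 <= Num.max T s1 by rewrite le_max lexx orbT.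
have [|||b s1b [ba Db]] := ivt s2.
- by apply: (le_trans s1m); rewrite lerDl.
- by rewrite ha leey.
- have Ts2 : T <= s2 by apply: (le_trans Tm); rewrite lerDl.
  have h1 := primR_upper y T0 Ts2.
  have h2 : (s2 - T) * rearrR y T <= (s2 - T) * (nu / 2) by rewrite ler_wpM2l ?subr_ge0// ltW.
  have h3 : nu * s2 = nu * Num.max T s1 + 2 * (primR y T + nu * t).
    by rewrite /s2 mulrDr; congr (_ + _); field; rewrite gt_eqF.
  have h4 : 0 <= nu * Num.max T s1 by rewrite mulr_ge0 ?(ltW nu0)// (le_trans (ltW T0)).
  have h5 : 0 <= T * nu by rewrite mulr_ge0 ?ltW.
  have h6 := primR_ge0 y t; have h7 := primR_ge0 y T.
  by rewrite /D; nra.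
by exists b; split => //; rewrite Db.
Qed.

Lemma ae_neq (c : R) : {ae mu, forall s : R, s <> c}.
Proof.
exists [set c]; split; [exact: measurable_set1|exact: lebesgue_measure_set1|].
by move=> s /= /contrapT.
Qed.

Lemma ereal_incr (I : \bar R) (a c a' c' : R) :
  c%:E = (a%:E + I)%E -> c'%:E = (a'%:E + I)%E -> c - a = c' - a'.
Proof. by case: I => [r| |]//= [->] [->]; rewrite ![_ + r - _]addrAC !subrr. Qed.

Lemma eq_prim_incr x y (u v : R) : 0 <= u -> u <= v ->
  {ae mu, forall s, u < s -> s <= v -> rearr (ev x) s = rearr (ev y) s} ->
  primR x v - primR x u = primR y v - primR y u.
Proof.
move=> u0 uv xy; have v0 := le_trans u0 uv.
have hx := prim_split (ev x) u0 uv; have hy := prim_split (ev y) u0 uv.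
have e : (\int[mu]_(s in `]u, v]) rearr (ev x) s = \int[mu]_(s in `]u, v]) rearr (ev y) s)%E.
  apply: ge0_ae_eq_integral; first exact: measurable_itv.
  - by apply: measurable_rearr; exact: measurable_itv.
  - by apply: measurable_rearr; exact: measurable_itv.
  - by move=> *; exact: rearr_ge0.
  - by move=> *; exact: rearr_ge0.
  by apply: filterS xy => s h /=; rewrite in_itv/= => /andP[]; exact: h.
move: hx hy; rewrite e (primE x u0) (primE x v0) (primE y u0) (primE y v0).
exact: ereal_incr.
Qed.

Lemma eq_prim0 x y (v : R) : 0 <= v ->
  {ae mu, forall s, 0 < s -> s <= v -> rearr (ev x) s = rearr (ev y) s} ->
  primR x v = primR y v.
Proof.
move=> v0 xy; have := eq_prim_incr (lexx 0) v0 xy.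
move: (primR_at0 x) (primR_at0 y); move: (primR x 0) (primR y 0) (primR x v) (primR y v) => a b c d -> ->.
by rewrite !subr0.
Qed.

Lemma cst_prim_incr x (c u v : R) : 0 <= u -> u <= v ->
  {ae mu, forall s, u < s -> s <= v -> rearr (ev x) s = c%:E} ->
  primR x v = primR x u + c * (v - u).
Proof.
move=> u0 uv xc; have v0 := le_trans u0 uv.
have [<-|nuv] := eqVneq u v; first by rewrite subrr mulr0 addr0.
have {nuv}uv : u < v by rewrite lt_neqAle nuv.
have hx := prim_split (ev x) u0 (ltW uv).
have e : (\int[mu]_(s in `]u, v]) rearr (ev x) s = \int[mu]_(s in `]u, v]) cst c%:E s)%E.
  apply: ae_eq_integral; first exact: measurable_itv.
  - by apply: measurable_rearr; exact: measurable_itv.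
  - exact: measurable_cst.
  by apply: filterS xc => s h /=; rewrite in_itv/= => /andP[]; exact: h.
move: hx; rewrite e (integral_cst_itv _ (ltW uv)) (primE x u0) (primE x v0).
by rewrite -EFinM -EFinD mulrC => -[].
Qed.

Lemma primR_off x (s : R) : (alpha <= s%:E)%E -> forall r, s <= r -> primR x r <= primR x s.
Proof.
move=> as_ r sr; have s0 : 0 < s by rewrite -lte_fin (lt_le_trans alpha_gt0).
have := primR_upper x s0 sr; rewrite [rearrR x s](_ : _ = 0) ?mulr0 ?addr0//.
apply: EFin_inj; rewrite -rearrE// rearr_off// ?ltW// => -[_].
by rewrite ltNge as_.
Qed.

(* The primitive of [z] is the minimum of [primR y] and of this line. *)
Lemma tangent_cut y (t nu : R) : cone y -> 0 < t -> dom t -> 0 < nu -> nu < rearrR y t ->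
  exists2 z : E, `|z| < `|y| & forall x, (forall s, 0 < s -> primR x s <= primR y s) ->
    rearrR x t < nu -> `|x| <= `|z|.
Proof.
move=> cy t0 dt nu0 nut.
have [s1 [b [/andP[ts1 s1b] ba hs1 hb1 hb2]]] := tangent_exit cy t0 dt nu0 nut.
have tb : t < b by exact: lt_le_trans s1b.
have b0 : 0 < b by exact: lt_trans tb.
(* From [s1], where it is strictly above the line, [primR y] descends onto it at [b], so its slope
   there is at most [nu]. This keeps [w] decreasing across [b]. *)
have Sb : (b%:E < alpha)%E -> rearrR y b <= nu.
  move=> /hb2 eb; have s1b' : s1 < b.
    rewrite lt_neqAle s1b andbT; apply/eqP => e; move: hs1; rewrite e eb.
    by rewrite ltxx.
  have := primR_lower y (ltW (lt_trans t0 ts1)) s1b'.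
  rewrite eb => h; have : (b - s1) * rearrR y b < (b - s1) * nu by nra.
  by rewrite ltr_pM2l ?subr_gt0// => /ltW.
pose w s : \bar R := if s < t then rearr (ev y) s else if s < b then nu%:E else rearr (ev y) s.
have w0 s : dom s -> (0 <= w s)%E.
  by move=> _; rewrite /w; do 2?[case: ifP => _]; rewrite ?rearr_ge0// lee_fin ltW.
have rt : (nu%:E <= rearr (ev y) t)%E by rewrite rearrE// lee_fin ltW.
have dw u v : dom u -> dom v -> u <= v -> (w v <= w u)%E.
  move=> du dv uv; rewrite /w.
  have [ut|tu] := ltP u t; have [vt|tv] := ltP v t; try exact: rearr_noninc.
  - have [vb|bv] := ltP v b; last exact: rearr_noninc.
    by apply: (le_trans rt); apply: rearr_noninc; exact: ltW.
  - by move: (le_lt_trans (le_trans tu uv) vt); rewrite ltxx.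
  have [vb|bv] := ltP v b; have [ub|bu] := ltP u b => //.
  - by move: (le_lt_trans (le_trans bu uv) vb); rewrite ltxx.
  - apply: (le_trans (rearr_noninc _ bv)); rewrite rearrE// lee_fin Sb//.
    by apply: le_lt_trans dv.2; rewrite lee_fin.
  exact: rearr_noninc.
(* [w] equals [nu] on [[t, b)] and [y] elsewhere, so it is dominated by [y] plus [nu] times the
   indicator of [[0, b)]. *)
have [e he] := chi_mem b.
have [|z zw] := @ideal_mem w (y + nu *: e) (measurable_decr dw).
  have h1 := bfs_add hb y (nu *: e); have h2 := bfs_scale hb nu e.
  have h3 := iffLR (coneP y) cy.
  have h4 : eqE (ev (nu *: e)) (fun s => nu%:E * chi b s)%E.
    by apply: filterS2 h2 he => s k2 k4 ds; rewrite k2// k4.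
  apply: filterS3 h1 h3 h4 => s k1 k3 k4 ds.
  rewrite k1// k3// k4//.
  have p0 : (0 <= nu%:E * chi b s)%E by rewrite mule_ge0 ?chi_ge0// lee_fin ltW.
  rewrite !gee0_abs ?w0 ?adde_ge0 ?rearr_ge0//.
  rewrite /w; case: ifP => _; first by rewrite leeDl.
  case: ifP => sb; last by rewrite leeDl.
  by rewrite /chi sb mule1 leeDr// rearr_ge0.
have [cz rz] := cone_rep w0 dw zw.
have hz : {ae mu, forall s, 0 <= s -> s <> t -> s <> b -> rearr (ev z) s = w s}.
  apply: filterS rz => s h s0 _ _; have [ds|nds] := pselect (dom s); first exact: h.
  rewrite rearr_off// /w.
  have as_ : (alpha <= s%:E)%E by rewrite leNgt; apply/negP => h'; apply: nds.
  have bs : b <= s by rewrite -lee_fin (le_trans ba).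
  by rewrite ltNge (le_trans (ltW tb) bs)/= ltNge bs/= rearr_off.
have hz' : {ae mu, forall s, 0 <= s -> rearr (ev z) s = w s}.
  apply: filterS3 hz (ae_neq t) (ae_neq b) => s h h1 h2 s0; exact: h.
have Pz1 s : 0 < s -> s <= t -> primR z s = primR y s.
  move=> s0 st; apply: eq_prim0; first exact: ltW.
  apply: filterS2 hz' (ae_neq t) => u h ut u0 us; rewrite h ?(ltW u0)// /w.
  by rewrite lt_neqAle (introN eqP ut) (le_trans us st).
have Pz2 s : t <= s -> s <= b -> primR z s = primR y t + nu * (s - t).
  move=> ts sb; rewrite -(Pz1 t)//; apply: cst_prim_incr => //; first exact: ltW.
  apply: filterS2 hz' (ae_neq b) => u h ub tu us; rewrite h ?(ltW (lt_trans t0 tu))// /w.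
  by rewrite ltNge (ltW tu)/= lt_neqAle (introN eqP ub) (le_trans us sb).
have Pz3 s : (b%:E < alpha)%E -> b <= s -> primR z s = primR y s.
  move=> ba' bs; have := @eq_prim_incr z y b s (ltW b0) bs.
  have -> : primR z b = primR y b by rewrite Pz2 ?hb2// ltW.
  move=> h; apply: (addIr (- primR y b)); apply: h.
  apply: filterS hz' => u h bu us; rewrite h ?(ltW (lt_trans b0 bu))// /w.
  by rewrite ltNge (ltW (lt_trans tb bu))/= ltNge (ltW bu).
(* If the slope at [s] is at least [nu], it is so on all of [[t, s]] and the comparison starts at
   [t]; otherwise it is below [nu] on [[s, b]] and the comparison is made backwards from [b]. *)
have chord s : t <= s -> s <= b -> primR y t + nu * (s - t) <= primR y s.
  rewrite le_eqVlt => /predU1P[<- _|ts sb]; first by rewrite subrr mulr0 addr0.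
  have [h|/ltW h] := leP nu (rearrR y s).
    apply: le_trans (primR_lower y (ltW t0) ts).
    by rewrite lerD2l mulrC ler_pM2l ?subr_gt0.
  have := primR_upper y (lt_trans t0 ts) sb.
  have : (b - s) * rearrR y s <= (b - s) * nu by rewrite ler_wpM2l ?subr_ge0.
  by move: hb1; lra.
have bcase : (b%:E < alpha)%E \/ (alpha <= b%:E)%E.
  by have [|] := leP alpha b%:E; [right|left].
have zy s : 0 < s -> primR z s <= primR y s.
  move=> s0; have [st|/ltW ts] := leP s t; first by rewrite Pz1.
  have [sb|/ltW bs] := leP s b; first by rewrite Pz2// chord.
  case: bcase => [ba'|ab]; first by rewrite Pz3.
  apply: (le_trans (primR_off z ab bs)); rewrite Pz2 ?(ltW tb)//.
  by apply: (le_trans hb1); apply: primR_le => //; exact: ltW.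
exists z.
  rewrite lt_neqAle kmono_primR// andbT; apply/eqP => e1.
  have e2 : z = y by apply: strict_mono_primR => //; rewrite e1.
  by move: hs1; rewrite -Pz2 ?(ltW ts1)// e2 ltxx.
move=> x xy xt; apply: kmono_primR => s s0.
have [st|/ltW ts] := leP s t; first by rewrite Pz1// xy.
(* At [t] the primitive of [x] is not above the line, and from there on its slope is at most
   [rearrR x t < nu]. *)
have hx u : t <= u -> u <= b -> primR x u <= primR z u.
  move=> tu ub; rewrite Pz2//; apply: (le_trans (primR_upper x t0 tu)).
  by rewrite lerD ?xy// mulrC ler_wpM2r ?subr_ge0// ltW.
have [sb|/ltW bs] := leP s b; first exact: hx.
case: bcase => [ba'|ab]; first by rewrite Pz3// xy.
apply: (le_trans (primR_off x ab bs)); apply: (le_trans (hx _ (ltW tb) (lexx _))).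
by apply: primR_le => //; exact: ltW.
Qed.

(** The element [z] of [tangent_cut] depends on [t] and [nu] but not on [n], so the single gap
    [|z| < |y|] excludes all large indices at once. *)
Lemma eventually_ge y (x : nat -> E) (t nu : R) : cone y ->
  (forall n s, 0 < s -> primR (x n) s <= primR y s) -> `|x n| @[n --> \oo] --> `|y| ->
  0 < t -> dom t -> 0 < nu -> nu < rearrR y t -> \forall n \near \oo, nu <= rearrR (x n) t.
Proof.
move=> cy xy xyn t0 dt nu0 nut.
have [z zy hz] := tangent_cut cy t0 dt nu0 nut.
have : \forall n \near \oo, `|z| < `|x n| by exact: cvgr_gt xyn _ zy.
apply: filterS => n zn; rewrite leNgt; apply/negP => h.
by have := hz (x n) (xy n) h; rewrite leNgt zn.
Qed.

(** * The Fatou property and the conclusion *)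

Hypothesis hfatou : fatou_property alpha ev.

Lemma submaj_norm_cvg y (x : nat -> E) : cone y -> 0 < `|y| ->
  (forall n, cone (x n)) -> (forall n s, 0 < s -> primR (x n) s <= primR y s) ->
  `|x n| @[n --> \oo] --> `|y| -> x @ \oo --> y.
Proof.
move=> cy y0 cx xy xyn.
pose f n t := rearr (ev (x n)) t.
(* The tail infima increase to the lower limit [H] and stay below [x n], so the ideal property
   represents them by elements [z n] to which the Fatou property applies. *)
pose h n t := einfs (f ^~ t) n.
pose H t := ereal_sup (range (h ^~ t)).
have mf n : measurable_fun dom (f n) by exact: measurable_rearr.
have mh n : measurable_fun dom (h n) by exact: measurable_fun_einfs.
have h_le n m t : (n <= m)%N -> (h n t <= f m t)%E.
  by move=> nm; apply: ereal_inf_lbound; exists m.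
have h0 n t : (0 <= h n t)%E.
  by apply: le_ereal_inf_tmp => _ [m _ <-]; exact: rearr_ge0.
have hH t : h n t @[n --> \oo] --> H t by exact: cvg_einfs_sup.
have mH : measurable_fun dom H.
  by apply: (emeasurable_fun_cvg h) => // t _; exact: hH.
have xf n : eqE (ev (x n)) (f n) by exact/coneP.
have /choice[z hz] : forall n, exists zn, eqE (ev zn) (h n) /\ `|zn| <= `|x n|.
  move=> n; have [|zn e1 e2] := bfs_ideal hb (mh n) (y := x n); last by exists zn.
  apply: filterS (xf n) => t e dt; rewrite e// !gee0_abs ?rearr_ge0//; exact: h_le.
have x_le n : `|x n| <= `|y| by apply: kmono_primR; exact: xy.
have [|||Z [ZH ndz zZ]] := @hfatou z H mH.
- by move=> n; apply: filterS (hz n).1 => t e dt; rewrite e.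
- by exists `|y| => n; exact: le_trans (hz n).2 (x_le n).
- have : {ae mu, forall t n, dom t -> ev (z n) t = h n t}.
    by apply: ae_foralln => n; exact: (hz n).1.
  apply: filterS => t e dt.
  have -> : (fun n => ev (z n) t) = h ^~ t by apply/funext => n; exact: e.
  by split; [exact: nondecreasing_einfs|exact: hH].
have yZ : `|y| <= `|Z|.
  apply: norm_le; apply: filterS3 ZH (iffLR (coneP y) cy) (ae_neq 0) => t e1 e2 t0 dt.
  have tpos : 0 < t by rewrite lt_neqAle eq_sym (introN eqP t0); case: dt.
  have H0 : (0 <= H t)%E by apply: le_trans (h0 0%N t) _; apply: ereal_sup_ubound; exists 0%N.
  rewrite e1// e2// !gee0_abs ?rearr_ge0// rearrE// leNgt; apply/negP => lt.
  have : H t \is a fin_num by rewrite ge0_fin_numE//; exact: lt_trans lt (ltry _).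
  move=> /fineK Hf; rewrite -Hf lte_fin in lt.
  (* A level strictly between [H t] and [rearrR y t] is positive, and by [eventually_ge] it would
     bound a tail of the sequence, hence [H t], from below. *)
  pose nu := (fine (H t) + rearrR y t) / 2.
  have [N _ hN] : \forall n \near \oo, nu <= rearrR (x n) t.
    apply: (eventually_ge cy xy xyn tpos dt); rewrite /nu; last by lra.
    by have := fine_ge0 H0; lra.
  have : (nu%:E <= H t)%E.
    apply: (@le_trans _ _ (h N t)); last by apply: ereal_sup_ubound; exists N.
    apply: le_ereal_inf_tmp => _ [m Nm <-].
    by rewrite /f rearrE// lee_fin; exact: hN.
  by rewrite -Hf lee_fin /nu; lra.
have Zy : `|Z| = `|y|.
  apply/eqP; rewrite eq_le yZ andbT -(cvg_lim _ zZ)//.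
  apply: limr_le; first by apply/cvg_ex; exists `|Z|.
  by apply: nearW => n; exact: le_trans (hz n).2 (x_le n).
rewrite Zy in zZ.
(* [z n] lies below every [x m] with [n <= m], so any sum of [k] such terms dominates [k] times
   [z n], and [|z n|] can serve as [r n]. *)
have [K cK xK] : exists2 K : set E, compact K & \forall n \near \oo, K (x n).
  apply: (rotund_compact y0 cx xyn zZ) => n phi hphi.
  have -> : k%:R * `|z n| = `|\sum_(i < k) z n|.
    by rewrite sumr_const card_ord normrMn mulr_natl.
  apply: norm_le.
  have xf' : {ae mu, forall t m, dom t -> ev (x m) t = f m t} by exact: ae_foralln.
  apply: filterS3 xf' (hz n).1 (filterI (ev_sum (index_enum 'I_k) (fun=> z n))
    (ev_sum (index_enum 'I_k) (fun i => x (phi i)))) => t e1 e2 [e3 e4] dt.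
  rewrite e3// e4//.
  have le_sum : (\sum_(i < k) ev (z n) t <= \sum_(i < k) ev (x (phi i)) t)%E.
    by apply: lee_sum => i _; rewrite e2// e1//; exact: h_le.
  have ge0 : (0 <= \sum_(i < k) ev (z n) t)%E.
    by apply: sume_ge0 => i _; rewrite e2.
  by rewrite !gee0_abs//; exact: le_trans le_sum.
apply: (cvg_unique_cluster cK xK) => w cw.
apply: strict_mono_primR => //; first exact: cluster_cone cw.
  by move=> t t0; apply: (cluster_primR_le cx cw (ltW t0)) => n; exact: xy.
by rewrite (cluster_norm xyn cw).
Qed.

Lemma submaj_primR x y : submaj alpha (ev x) (ev y) -> forall t, 0 < t -> primR x t <= primR y t.
Proof.
move=> /submajP xy t t0; have := xy t t0.
by rewrite (primE x (ltW t0)) (primE y (ltW t0)).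
Qed.

Lemma increasing_uniformly : increasing_uniformly_K_monotone alpha ev.
Proof.
move=> x y l hxy xl yl.
have /choice[xs hxs] := fun n => rearr_elem (x n).
have /choice[ys hys] := fun n => rearr_elem (y n).
exists xs, ys; split; [by move=> n; case: (hxs n)|by move=> n; case: (hys n)|].
have nx n : `|xs n| = `|x n| by case: (hxs n).
have ny n : `|ys n| = `|y n| by case: (hys n).
have cx n : cone (xs n) by case: (hxs n).
have cy n : cone (ys n) by case: (hys n).
have Px n t : primR (xs n) t = primR (x n) t by rewrite !primRE /prim; case: (hxs n) => _ _ _ ->.
have Py n t : primR (ys n) t = primR (y n) t by rewrite !primRE /prim; case: (hys n) => _ _ _ ->.
have xsl : `|xs n| @[n --> \oo] --> l by under eq_fun do rewrite nx.
have ysl : `|ys n| @[n --> \oo] --> l by under eq_fun do rewrite ny.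
have : 0 <= l.
  rewrite -(cvg_lim _ xl)//; apply: limr_ge; first by apply/cvg_ex; exists l.
  exact: nearW.
(* For [l = 0] the triangle inequality suffices; normalization in [rotund_compact] needs [l > 0]. *)
rewrite le_eqVlt => /predU1P[l0|l0].
  rewrite -l0 in xsl ysl.
  have : `|xs n| + `|ys n| @[n --> \oo] --> (0 + 0 : R) by exact: cvgD.
  rewrite addr0; apply: squeeze_cvgr; last exact: cvg_cst.
  by apply: nearW => n; rewrite normr_ge0/= ler_normB.
have [n t t0|p [cp ysp Pp]] := submaj_cvg l0 cy _ ysl.
  by rewrite !Py; exact: submaj_primR (hxy n).2 t t0.
have pl : `|p| = l.
  have h : `|ys n| @[n --> \oo] --> `|p| by exact: cvg_norm.
  by rewrite -(cvg_lim _ h)// (cvg_lim _ ysl).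
have xsp : xs @ \oo --> p.
  apply: submaj_norm_cvg => //; [by rewrite pl| |by rewrite pl].
  move=> n t t0; apply: le_trans (Pp n t t0).
  by rewrite Px Py; exact: submaj_primR (hxy n).1 t t0.
have : `|xs n - ys n| @[n --> \oo] --> `|p - p| by apply: cvg_norm; exact: cvgB.
by rewrite subrr normr0.
Qed.
End SymmetricSpaces.

Theorem theorem5p8 (R : realType) (alpha : \bar R)
    (halpha : alpha = 1%:E \/ alpha = +oo%E)
    (E : completeNormedModType R) (ev : E -> R -> \bar R)
    (hsym : symmetric_space alpha ev) (hfatou : fatou_property alpha ev)
    (k : nat) (hk : (2 <= k)%N)
    (hrot : compactly_fully_rotund_on k (decr_cone alpha ev))
    (hskm : strictly_K_monotone_on alpha ev (decr_cone alpha ev)) :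
  increasing_uniformly_K_monotone alpha ev.
Proof. exact: increasing_uniformly hk hrot hfatou. Qed.
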